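(* Let $0<r<1$. For any $\lambda>0$, the moments $m_n(\mu_{P_\lambda^{QW}})$ of $\mu_{P_\lambda^{QW}}$ are determined by the power series identity (in $z$, for $|z|$ sufficiently small) $$\sum_{n\ge0}m_n(\mu_{P_\lambda^{QW}})z^n=1+\lambda z+\lambda\sum_{n\ge1}z^{n+1}\left(\widetilde\alpha_1+\widetilde\omega_1z+\widetilde\omega_1\sum_{k\ge1}z^{k+1}\left(\widetilde\alpha_2+\widetilde\omega_2z+\widetilde\omega_2\sum_{l\ge1}m_l(\mathrm{SC}_{\widetilde\alpha,\widetilde\omega})z^{l+1}\right)^k\right)^n.$$ In particular, - $m_1(\mu_{P_\lambda^{QW}})=\lambda$; - $m_2(\mu_{P_\lambda^{QW}})=\lambda(\lambda+\omega_1)$; - $m_3(\mu_{P_\lambda^{QW}})=\lambda(\lambda^2+3\lambda\omega_1+\omega_1^2)$; - $m_4(\mu_{P_\lambda^{QW}})=\lambda\left(\lambda^3+6\lambda^2\omega_1+\lambda\omega_1(5\omega_1+\omega_2)+\omega_1^3\right)$.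
   Context: Fix $r\in(0,1)$ and let $\omega_1=1-\sqrt{1-r^2}$, $\omega_2=\frac{\sqrt{1-r^2}}{2}\omega_1$, $\omega=\frac{r^2}{4}$, and $\omega_n=\omega$ for $n\ge3$. Let $\mathcal H$ be a complex Hilbert space with complete orthonormal system $\{\Phi_n\}_{n\ge0}$, and let $B_+^{QW},B_-^{QW}$ be the bounded operators with $B_+^{QW}\Phi_n=\sqrt{\omega_{n+1}}\,\Phi_{n+1}$ ($n\ge0$), $B_-^{QW}\Phi_n=\sqrt{\omega_n}\,\Phi_{n-1}$ ($n\ge1$), $B_-^{QW}\Phi_0=0$; they are mutually adjoint. For $\lambda>0$ put $P_\lambda^{QW}=(B_+^{QW}+\sqrt\lambda I)(B_-^{QW}+\sqrt\lambda I)$, with spectral distribution $\mu_{P_\lambda^{QW}}(B)=\langle\Phi_0,E(B)\Phi_0\rangle$, $E$ being its spectral measure. Notation: $\widetilde\alpha_1=\lambda+\omega_1$, $\widetilde\alpha_2=\lambda+\omega_2$, $\widetilde\alpha=\lambda+\omega$, $\widetilde\omega_1=\lambda\omega_1$, $\widetilde\omega_2=\lambda\omega_2$, $\widetilde\omega=\lambda\omega$. For a probability measure $\mu$, $m_n(\mu)=\int x^n\mu(dx)$, $m_0(\mu)=1$. $\mathrm{SC}_{m,v}$ is the semicircle law with mean $m$ and variance $v$: $\mathrm{SC}_{m,v}(dx)=\frac1{2\pi v}\sqrt{4v-(x-m)^2}\,\mathbf 1_{[m-2\sqrt v,m+2\sqrt v]}(x)\,dx$. *)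

(* Defs.v *)
From HB Require Import structures.
From mathcomp Require Import all_boot all_order all_algebra.
From mathcomp Require Import complex.
From mathcomp Require Import all_classical all_reals all_analysis.
From mathcomp Require Import measurable_realfun.
Set Implicit Arguments.
Unset Strict Implicit.
Unset Printing Implicit Defensive.
Import Order.TTheory GRing.Theory Num.Theory.
Import numFieldNormedType.Exports.
Local Open Scope classical_set_scope.
Local Open Scope complex_scope.
Local Open Scope ring_scope.

(* The inner product is linear in its first and antilinear in its second
   argument; completeness is the metric completeness inherited from
   CompleteNormedModule. *)
HB.mixin Record isHilbert (R : realType) H of CompleteNormedModule R[i] H := {
  inner : {dot H for (@Num.conj R[i])} ;
  innerxx : forall x : H, inner x x = `|x| ^+ 2
}.

#[short(type="hilbertType")]
HB.structure Definition Hilbert (R : realType) :=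
  {H of isHilbert R H & CompleteNormedModule R[i] H}.

Section inner_product.
Variables (R : realType) (H : hilbertType R).
Implicit Types x y z : H.

Lemma innerC x y : inner y x = (inner x y)^*%C.
Proof. by rewrite hermC expr0 mul1r. Qed.

Lemma inner_cauchy_schwarz x y : `|inner x y| <= `|x| * `|y|.
Proof.
have [->|y0] := eqVneq y 0; first by rewrite linear0 !normr0 mulr0.
have ny0 : 0 < `|y| ^+ 2 by rewrite exprn_gt0// normr_gt0.
pose c := inner x y / `|y| ^+ 2.
have : 0 <= inner (x - c *: y) (x - c *: y) by rewrite innerxx exprn_ge0.
have cy : inner (x - c *: y) y = 0.
  by rewrite linearBl/= linearZl_LR/= innerxx divfK ?subrr// gt_eqF.
rewrite raddfB/= [X in _ - X]linearZ/= cy mulr0 subr0 linearBl/= linearZl_LR/=.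
rewrite innerxx innerC mulrAC -sqr_normc subr_ge0 ler_pdivrMr// -exprMn.
by rewrite ler_sqr// nnegrE mulr_ge0.
Qed.

End inner_product.

Definition orthonormal_seq (R : realType) (H : hilbertType R) (Phi : nat -> H) :=
  forall i j, inner (Phi i) (Phi j) = (i == j)%:R.

Definition complete_orthonormal_seq (R : realType) (H : hilbertType R)
    (Phi : nat -> H) :=
  orthonormal_seq Phi /\
  forall x : H, (forall n, inner x (Phi n) = 0) -> x = 0.

Definition orthogonal_projection (R : realType) (H : hilbertType R)
    (p : {linear H -> H}) :=
  (forall x, p (p x) = p x) /\ (forall x y, inner (p x) y = inner x (p y)).

(* Projection-valued measures on the Borel sets of R. The function is total on
   sets; its values off the Borel sets are arbitrary projections. *)
Record pvm (R : realType) (H : hilbertType R) := PVM {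
  pvm_fun :> set (measurableTypeR R) -> {linear H -> H} ;
  pvm_projection : forall B, orthogonal_projection (pvm_fun B) ;
  pvm0 : forall x, pvm_fun set0 x = 0 ;
  pvmT : forall x, pvm_fun setT x = x ;
  pvmI : forall A B, measurable A -> measurable B ->
    forall x, pvm_fun (A `&` B) x = pvm_fun A (pvm_fun B x) ;
  pvm_sigma_additive : forall F : (set (measurableTypeR R))^nat,
    (forall n, measurable (F n)) -> trivIset setT F ->
    forall x, (fun n => \sum_(0 <= i < n) pvm_fun (F i) x) @ \oo -->
              pvm_fun (\bigcup_n F n) x
}.

(* The measure B |-> <u, E(B) u>; the inner product is real here. *)
Definition spectral_distribution (R : realType) (H : hilbertType R)
    (E : pvm H) (u : H) : set (measurableTypeR R) -> \bar R :=
  fun B => (complex.Re (inner u (E B u)))%:E.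

Section spectral_distribution_measure.
Variables (R : realType) (H : hilbertType R) (E : pvm H) (u : H).
Local Notation mu := (spectral_distribution E u).

Let mu0 : mu set0 = 0%E.
Proof. by rewrite /spectral_distribution pvm0 linear0. Qed.

Let mu_ge0 B : (0 <= mu B)%E.
Proof.
have [EE Esym] := pvm_projection E B.
have : 0 <= inner u (E B u) by rewrite -EE -Esym innerxx exprn_ge0.
by rewrite lecE lee_fin => /andP[].
Qed.

Let mu_sigma_additive : semi_sigma_additive mu.
Proof.
move=> F mF tF mUF.
have := @pvm_sigma_additive _ _ E F mF tF u.
set s := (X in X @ _ --> _) => sE.
rewrite (_ : (fun n => _) = EFin \o (fun n => complex.Re (inner u (s n)))).
  apply: cvg_EFin; first exact: nearW.
  apply/cvgrPdist_lt => e e0 /=.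
  have d0 : 0 < e%:C / (`|u| + 1) :> R[i].
    by rewrite divr_gt0 ?ltcR// ltr_wpDl.
  move/cvgrPdist_lt : sE => /(_ _ d0); apply: filterS => n.
  rewrite ltr_pdivlMr ?ltr_wpDl// => sn.
  rewrite -raddfB/= -raddfB/= -ltcR; apply: le_lt_trans sn.
  apply: le_trans (normc_ge_Re _) _.
  apply: le_trans (inner_cauchy_schwarz _ _) _.
  by rewrite mulrC ler_wpM2l// lerDl.
apply/funext => n /=; rewrite /s raddf_sum/= raddf_sum/=.
by rewrite sumEFin.
Qed.

HB.instance Definition _ := isMeasure.Build _ _ _
  mu mu0 mu_ge0 mu_sigma_additive.

End spectral_distribution_measure.

(* E is the spectral measure of the bounded operator T, i.e. E is a
   projection-valued measure of bounded support with T = \int x E(dx). The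
   integral is meant weakly; by polarization it is enough to test it on the
   diagonal. *)
Definition spectral_measure_of (R : realType) (H : hilbertType R)
    (T : H -> H) (E : pvm H) :=
  (exists M : R, forall x, E `[- M, M]%classic x = x) /\
  (forall u : H,
     inner u (T u) = (\int[spectral_distribution E u]_x x)%:C).

Definition moment (R : realType)
    (mu : {measure set (measurableTypeR R) -> \bar R}) (n : nat) : R :=
  \int[mu]_x (x ^+ n).

Section semicircle.
Variables (R : realType) (m v : R).

Definition semicircle_pdf (x : R) : R :=
  (2 * pi * v)^-1 * Num.sqrt (4 * v - (x - m) ^+ 2) *
  \1_(`[m - 2 * Num.sqrt v, m + 2 * Num.sqrt v]%classic : set R) x.

Definition semicircle : set (measurableTypeR R) -> \bar R :=
  fun B => (\int[lebesgue_measure]_(x in B) (semicircle_pdf x)%:E)%E.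

Lemma semicircle_pdf_ge0 x : 0 <= semicircle_pdf x.
Proof.
rewrite /semicircle_pdf mulr_ge0//.
have [v0|v0] := leP 0 v.
  by rewrite mulr_ge0 ?sqrtr_ge0// invr_ge0 mulr_ge0// mulr_ge0// pi_ge0.
rewrite ler0_sqrtr ?mulr0// subr_le0 (le_trans _ (sqr_ge0 _))//.
by rewrite mulr_ge0_le0// ltW.
Qed.

Lemma measurable_semicircle_pdf : measurable_fun setT semicircle_pdf.
Proof.
apply: measurable_funM; last exact: measurable_indic.
apply: measurable_funM => //.
apply: measurableT_comp; first exact: continuous_measurable_fun (@sqrt_continuous R).
apply: measurable_funB => //; apply: measurable_funX; exact: measurable_funB.
Qed.

Let semicircle0 : semicircle set0 = 0%E.
Proof. by rewrite /semicircle integral_set0. Qed.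

Let semicircle_ge0 B : (0 <= semicircle B)%E.
Proof.
by apply: integral_ge0 => x _; rewrite lee_fin semicircle_pdf_ge0.
Qed.

Let semicircle_sigma_additive : semi_sigma_additive semicircle.
Proof.
move=> F mF tF mUF; rewrite /semicircle ge0_integral_bigcup//; last 2 first.
- by apply/measurable_EFinP; apply: measurable_funTS; exact: measurable_semicircle_pdf.
- by move=> x _; rewrite lee_fin semicircle_pdf_ge0.
apply: is_cvg_ereal_nneg_natsum_cond => n _ _.
by apply: integral_ge0 => x _; rewrite lee_fin semicircle_pdf_ge0.
Qed.

HB.instance Definition _ := isMeasure.Build _ _ _
  semicircle semicircle0 semicircle_ge0 semicircle_sigma_additive.

End semicircle.

Section quantum_walk.
Variable R : realType.

(* The value at 0 is unused. *)
Definition omegaQW (r : R) (n : nat) : R :=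
  match n with
  | 0%N => 0
  | 1%N => 1 - Num.sqrt (1 - r ^+ 2)
  | 2%N => Num.sqrt (1 - r ^+ 2) / 2 * (1 - Num.sqrt (1 - r ^+ 2))
  | _ => r ^+ 2 / 4
  end.

Definition PQW (H : hilbertType R) (Bp Bm : H -> H) (lam : R) (x : H) : H :=
  let y := Bm x + (Num.sqrt lam)%:C *: x in
  Bp y + (Num.sqrt lam)%:C *: y.

Variables (r lam : R).
Local Notation omega := (omegaQW r).
Local Notation C := (R[i]^o).

(* The terms of the three nested series, from the innermost outwards; the
   index 3 stands for the constant tail of omega. *)
Definition term3 (z : C) (l : nat) : C :=
  (moment (semicircle (lam + omega 3%N) (lam * omega 3%N)) l)%:C * z ^+ l.+1.

Definition inner3 (z : C) : C :=
  (lam + omega 2%N)%:C + (lam * omega 2%N)%:C * z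
  + (lam * omega 2%N)%:C * \big[+%R/0]_(1 <= l <oo) term3 z l.

Definition term2 (z : C) (k : nat) : C := z ^+ k.+1 * inner3 z ^+ k.

Definition inner2 (z : C) : C :=
  (lam + omega 1%N)%:C + (lam * omega 1%N)%:C * z
  + (lam * omega 1%N)%:C * \big[+%R/0]_(1 <= k <oo) term2 z k.

Definition term1 (z : C) (n : nat) : C := z ^+ n.+1 * inner2 z ^+ n.

Definition rhsQW (z : C) : C :=
  1 + lam%:C * z + lam%:C * \big[+%R/0]_(1 <= n <oo) term1 z n.

(* "_(1 <= n <oo)" is a total limit, so convergence of all the series
   involved is part of the identity. *)
Definition moment_identity (a : nat -> R) :=
  \forall z \near (0 : C),
    [/\ cvgn (fun N => \sum_(1 <= l < N) term3 z l),
        cvgn (fun N => \sum_(1 <= k < N) term2 z k),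
        cvgn (fun N => \sum_(1 <= n < N) term1 z n) &
        (fun N => \sum_(0 <= n < N) (a n)%:C * z ^+ n : C) @ \oo --> rhsQW z].

End quantum_walk.

(* Main.v *)
Require Import Defs.
From HB Require Import structures.
From mathcomp Require Import all_boot all_order all_algebra.
From mathcomp Require Import complex ring lra.
From mathcomp Require Import all_classical all_reals all_analysis.
From mathcomp Require Import measurable_realfun.
Set Implicit Arguments.
Unset Strict Implicit.
Unset Printing Implicit Defensive.
Import Order.TTheory GRing.Theory Num.Theory.
Import numFieldNormedType.Exports.
Local Open Scope classical_set_scope.
Local Open Scope complex_scope.
Local Open Scope ring_scope.

(** Why the theorem holds. Put s = sqrt lambda, A = B_+ + s and A* = B_- + s, so
    that P = A A*. In the basis Phi_n the operator P is tridiagonal, and the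
    n-th moment of its spectral distribution at Phi_0 is <Phi_0, P^n Phi_0>. Since
    A* Phi_0 = s Phi_0, the generating series of these numbers is
    1 + lambda z M(z), where M is the one of A* A, again tridiagonal with
    diagonal lambda + omega_(k+1) and squared off-diagonal lambda omega_k.
    Hence M is the continued fraction
        M = 1 / (1 - z J1),  J1 = alpha_1 + omega'_1 z K,
        K = 1 / (1 - z J2),  J2 = alpha_2 + omega'_2 z G,
    where alpha_k = lambda + omega_k and omega'_k = lambda omega_k; the tail
    has constant coefficients and its value G satisfies
    G = 1 + alpha z G + omega' z^2 G^2, so it is the moment series of the
    semicircle law. Expanding both fractions as geometric series gives the
    stated identity.

    Three facts carry the proof.

    - Moments from the spectral measure ([moment_spectral_distribution]). The
      hypothesis says only that <u, T u> is the integral of x for the measure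
      mu_u = <u, E(.) u>. Its additivity under u = E(A) u + E(~A) u gives
      Re <u, E(A) T u> = int_A x dmu_u, and polarization then says that
      mu_(u + T u) - mu_(u - T u) has density 4x with respect to mu_u. Moments
      of all orders follow by induction.

    - Moments of the semicircle law ([moment_semicircle]). Its monic orthogonal
      polynomials are Chebyshev polynomials, orthogonal to 1 by their
      differential equation and one integration by parts; multiplication by X
      is thus a Jacobi operator with constant coefficients.

    - Summation ([jacobi_resolvent]). For small z the series of the
      <delta_0, J^n delta_0> converges to the coordinate 0 of any bounded
      solution of y = delta_0 + z J y. For the semicircle law such a solution is
      geometric ([semicircle_series]); for P it is deduced from that of A* A
      ([jacobi_series]).

    The moments are determined because a power series that vanishes near 0 has
    zero coefficients ([power_series_inj]), and the first four are read off the
    tridiagonal matrix. *)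

(** * Measures with densities *)

Section density.
Context d (T : measurableType d) (R : realType).
Local Open Scope ereal_scope.
Import HBNNSimple.

(** The limit on the right depends on m, mu and g only through the set function
    A |-> m A + \int[mu]_(x in A) g x, because the integrals of simple functions
    do. *)
Lemma integral_add_density_lim (m mu : {measure set T -> \bar R}) (g f : T -> R)
    (mf : measurable_fun setT (fun x => (f x)%:E)) :
  measurable_fun setT g -> (forall x, 0 <= g x)%R -> (forall x, 0 <= f x)%R ->
  \int[m]_x (f x)%:E + \int[mu]_x (f x * g x)%:E =
  limn (fun n => let h := nnsfun_approx measurableT mf n in
    \sum_(y \in range h) y%:E *
      (m (h @^-1` [set y]) + \int[mu]_(x in h @^-1` [set y]) (g x)%:E)).
Proof.
move=> mg g0 f0.
pose h := nnsfun_approx measurableT mf.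
have hcvg x : (h n x)%:E @[n --> \oo] --> (f x)%:E.
  by apply: cvg_nnsfun_approx => // y _; rewrite lee_fin.
have hnd x (a b : nat) : (a <= b)%N -> (h a x <= h b x)%R.
  by move=> ab; exact/lefP/nd_nnsfun_approx.
have hmono x (a b : nat) : (a <= b)%O -> (h a x)%:E <= (h b x)%:E.
  by move=> ab; rewrite lee_fin; exact: hnd.
have hgmono x (a b : nat) : (a <= b)%O -> (h a x * g x)%:E <= (h b x * g x)%:E.
  by move=> ab; rewrite lee_fin ler_wpM2r// hnd.
have mh n : measurable_fun setT (fun x => (h n x)%:E) by exact/measurable_EFinP.
have mhg n : measurable_fun setT (fun x => (h n x * g x)%:E).
  by apply/measurable_EFinP; exact: measurable_funM.
have c1 : \int[m]_x (h n x)%:E @[n --> \oo] --> \int[m]_x (f x)%:E.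
  have -> : \int[m]_x (f x)%:E = \int[m]_x limn (fun n => (h n x)%:E).
    by apply: eq_integral => x _; apply/esym/cvg_lim.
  apply: cvg_monotone_convergence => //.
    by move=> n x _; rewrite lee_fin.
  by move=> x _ a b; exact: hmono.
have c2 : \int[mu]_x (h n x * g x)%:E @[n --> \oo] -->
          \int[mu]_x (f x * g x)%:E.
  have -> : \int[mu]_x (f x * g x)%:E =
            \int[mu]_x limn (fun n => (h n x * g x)%:E).
    apply: eq_integral => x _; apply/esym/cvg_lim => //.
    under eq_fun do rewrite EFinM; rewrite EFinM.
    by apply: cvgeZr.
  apply: cvg_monotone_convergence => //.
    by move=> n x _; rewrite lee_fin mulr_ge0.
  by move=> x _ a b; exact: hgmono.
symmetry; apply: cvg_lim => //=.
apply: cvg_trans (cvgeD _ c1 c2); last first.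
  by rewrite ge0_adde_def// inE integral_ge0// => x _; rewrite lee_fin ?mulr_ge0.
apply: near_eq_cvg; near=> n.
rewrite integralT_nnsfun sintegralE.
transitivity (\sum_(y \in range (h n)) y%:E * m (h n @^-1` [set y]) +
   \sum_(y \in range (h n)) y%:E * \int[mu]_(x in h n @^-1` [set y]) (g x)%:E).
  congr (_ + _).
  transitivity (\int[mu]_x (\sum_(y \in range (h n))
      (y * \1_(h n @^-1` [set y]) x)%:E * (g x)%:E)).
    apply: eq_integral => x _.
    rewrite -ge0_mule_fsuml => [|y]; last exact: nnfun_muleindic_ge0.
    by rewrite fsumEFin// -(fimfunE _ x).
  rewrite ge0_integral_fsum//; last 2 first.
  - move=> y; apply/measurable_EFinP; do 2 apply: measurable_funM => //.
  - move=> y x _; apply: mule_ge0; last by rewrite lee_fin.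
    exact: nnfun_muleindic_ge0.
  apply: eq_fsbigr => y; rewrite inE => -[x _ <-].
  under eq_integral do rewrite EFinM -muleA.
  rewrite ge0_integralZl//; last 3 first.
  - by apply/measurable_EFinP; apply: measurable_funM.
  - by move=> t _; rewrite lee_fin mulr_ge0.
  - by rewrite lee_fin.
  congr (_ * _); rewrite [RHS]integral_mkcond.
  apply: eq_integral => t _; rewrite patchE indicE.
  by case: ifPn => _; rewrite ?mul1e ?mul0e.
rewrite -fsbig_split//=.
apply: eq_fsbigr => y; rewrite inE => -[x _ <-].
rewrite [RHS]ge0_muleDr//.
by apply: integral_ge0 => t _; rewrite lee_fin.
Unshelve. all: by end_near. Qed.

(** Two densities, one on each side, allow an identity between measures that
    involves a signed density to be written with nonnegative terms only. *)
Lemma integral_add_density (m1 m2 mu : {measure set T -> \bar R})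
    (g1 g2 f : T -> R) :
  measurable_fun setT g1 -> (forall x, 0 <= g1 x)%R ->
  measurable_fun setT g2 -> (forall x, 0 <= g2 x)%R ->
  (forall A, measurable A -> m1 A + \int[mu]_(x in A) (g1 x)%:E =
                             m2 A + \int[mu]_(x in A) (g2 x)%:E) ->
  measurable_fun setT f -> (forall x, 0 <= f x)%R ->
  \int[m1]_x (f x)%:E + \int[mu]_x (f x * g1 x)%:E =
  \int[m2]_x (f x)%:E + \int[mu]_x (f x * g2 x)%:E.
Proof.
move=> mg1 g10 mg2 g20 E mf f0.
have mf' : measurable_fun setT (fun x => (f x)%:E) by exact/measurable_EFinP.
rewrite !(integral_add_density_lim _ _ mf')//.
by apply: congr_lim; apply/funext => n /=; apply: eq_fsbigr => y _; rewrite E.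
Qed.

End density.

(** The positive and negative parts of f g are those of f multiplied by g, so
    both sides split into the same two nonnegative integrals. *)
Lemma integral_density d (T : measurableType d) (R : realType)
    (m mu : {measure set T -> \bar R}) (g f : T -> R) :
  measurable_fun setT g -> (forall x, 0 <= g x) ->
  (forall A, measurable A -> m A = (\int[mu]_(x in A) (g x)%:E)%E) ->
  measurable_fun setT f ->
  (\int[m]_x (f x)%:E = \int[mu]_x (f x * g x)%:E)%E.
Proof.
move=> mg g0 mE mf.
have ge0_density (h : T -> R) : measurable_fun setT h -> (forall x, 0 <= h x) ->
    (\int[m]_x (h x)%:E = \int[mu]_x (h x * g x)%:E)%E.
  move=> mh h0.
  have := @integral_add_density _ T R m mzero mu (cst 0) g h _ _ mg g0 _ mh h0.
  rewrite integral_measure_zero add0e.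
  under [X in (_ + X)%E]eq_integral do rewrite mulr0.
  rewrite integral0 adde0; apply => // A mA.
  by rewrite integral0 adde0 mE// -[LHS]add0e.
rewrite integralE [RHS]integralE; congr (_ - _)%E.
  transitivity (\int[m]_x (Num.max (f x) 0)%:E)%E.
    by apply: eq_integral => x _; rewrite funeposE -EFin_max.
  rewrite ge0_density//; last 2 first.
  - exact: measurable_maxr.
  - by move=> x; rewrite le_max lexx orbT.
  apply: eq_integral => x _; rewrite funeposE -EFin_max; congr EFin.
  by rewrite maxr_pMl// mul0r.
transitivity (\int[m]_x (Num.max (- f x) 0)%:E)%E.
  by apply: eq_integral => x _; rewrite funenegE -EFin_max.
rewrite ge0_density//; last 2 first.
- by apply: measurable_maxr => //; exact: measurable_funN.
- by move=> x; rewrite le_max lexx orbT.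
apply: eq_integral => x _; rewrite funenegE -EFin_max; congr EFin.
by rewrite maxr_pMl// mul0r mulNr.
Qed.

(** * Moments of a spectral measure *)

Section spectral_moments.
Variables (R : realType) (H : hilbertType R).
Implicit Types u v w : H.

Local Notation Rinner u v := (complex.Re (inner u v)).

Lemma Re_innerC u v : Rinner u v = Rinner v u.
Proof. by rewrite innerC; case: (inner v u). Qed.

Lemma Re_innerDl u v w : Rinner (u + v) w = Rinner u w + Rinner v w.
Proof. by rewrite linearDl raddfD. Qed.

Lemma Re_innerNl u v : Rinner (- u) v = - Rinner u v.
Proof. by rewrite linearNl raddfN. Qed.

Lemma Re_innerDr u v w : Rinner u (v + w) = Rinner u v + Rinner u w.
Proof. by rewrite !(Re_innerC u) Re_innerDl. Qed.

Lemma Re_innerNr u v : Rinner u (- v) = - Rinner u v.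
Proof. by rewrite !(Re_innerC u) Re_innerNl. Qed.

Lemma Re_innerZr (c : R) u v : Rinner u (c%:C *: v) = c * Rinner u v.
Proof.
rewrite (Re_innerC u) linearZl_LR (Re_innerC u) /=.
by case: (inner v u) => a b; rewrite /= /GRing.scale/= ?mul0r subr0.
Qed.

Variable E : pvm H.
Local Notation mu := (spectral_distribution E).
Local Notation Borel := (set (measurableTypeR R)).

Lemma pvm_sym (A : Borel) u v : Rinner (E A u) v = Rinner u (E A v).
Proof. by rewrite (pvm_projection E A).2. Qed.

Lemma spectral_distribution_pvm (A B : Borel) u :
  measurable A -> measurable B ->
  mu (E A u) B = mu u (A `&` B).
Proof.
move=> mA mB; rewrite /spectral_distribution; congr EFin.
rewrite pvm_sym -!pvmI//; last exact: measurableI.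
by rewrite setIAC setIid.
Qed.

(** Polarization: the difference of the spectral distributions of u + w and of
    u - w recovers the signed measure A |-> 4 Re <u, E(A) w>. *)
Lemma spectral_distribution_polar (A : Borel) u w :
  Rinner (u + w) (E A (u + w)) = Rinner (u - w) (E A (u - w)) +
    4 * Rinner u (E A w).
Proof.
rewrite (raddfD (E A)) (raddfB (E A)).
rewrite !Re_innerDl !Re_innerDr !Re_innerNl !Re_innerNr.
have -> : Rinner w (E A u) = Rinner u (E A w) by rewrite -pvm_sym Re_innerC.
ring.
Qed.

Variables (T : {linear H -> H}) (M : R).
Hypothesis EM : forall x, E `[- M, M]%classic x = x.
Hypothesis ET : forall u, inner u (T u) = (\int[mu u]_x x)%:C.

Let bounded_supp (f : R -> R) :=
  exists C : R, forall x : R, `[- M, M]%classic x -> `|f x| <= C.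

Let bounded_suppM (f g : R -> R) : bounded_supp f -> bounded_supp g ->
  bounded_supp (fun x => f x * g x).
Proof.
move=> [C fC] [D gD]; exists (C * D) => x Mx.
by rewrite normrM ler_pM// ?fC ?gD.
Qed.

Let bounded_supp_maxr (f : R -> R) : bounded_supp f ->
  bounded_supp (fun x => Num.max (f x) 0).
Proof.
move=> [C fC]; exists C => x /fC; apply: le_trans.
by rewrite /Num.max; case: ifPn => // _; rewrite normr0.
Qed.

Let bounded_suppN (f : R -> R) : bounded_supp f ->
  bounded_supp (fun x => - f x).
Proof. by move=> [C fC]; exists C => x /fC; rewrite normrN. Qed.

Let bounded_supp_cst (c : R) : bounded_supp (fun=> c).
Proof. by exists `|c|. Qed.

Let bounded_supp_id : bounded_supp (fun x => x).
Proof. by exists M => x; rewrite /= in_itv/= -ler_norml. Qed.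

Let bounded_suppX n : bounded_supp (fun x => x ^+ n).
Proof.
elim: n => [|n IH].
  by under eq_fun do rewrite expr0; exact: bounded_supp_cst.
by under eq_fun do rewrite exprS; exact: bounded_suppM.
Qed.

(** The form <u, T u> is real-valued; its imaginary part at u + i w is the
    difference of the two sides. *)
Lemma Re_spectral_sym u w : Rinner u (T w) = Rinner (T u) w.
Proof.
pose i : R[i] := 0 +i* 1.
have Ti : T (u + i *: w) = T u + i *: T w by rewrite linearD linearZ.
have innerZr c x y : inner x (c *: y) = c^*%C * inner x y by rewrite linearZ.
have innerZl c x y : inner (c *: x) y = c * inner x y by rewrite linearZl_LR.
have innerDr x y z : inner x (y + z) = inner x y + inner x z by rewrite raddfD.
have innerDl x y z : inner (x + y) z = inner x z + inner y z by rewrite linearDl.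
have := congr1 (@complex.Im R) (ET (u + i *: w)).
rewrite Ti innerDl !innerDr !innerZl !innerZr !ET (Re_innerC (T u)).
case: (inner u (T w)) => a b; case: (inner w (T u)) => c d /=.
rewrite !(mul0r, mulr0, mul1r, mulN1r, subr0, add0r, addr0, oppr0).
by lra.
Qed.

Lemma pvm_split (A : Borel) u : measurable A -> u = E A u + E (~` A) u.
Proof.
move=> mA; have mAC : measurable (~` A) by exact: measurableC.
have EU : E (\bigcup_n bigcup2 A (~` A) n) u = u.
  by rewrite bigcup2E setUv; exact: pvmT.
have mF n : measurable (bigcup2 A (~` A) n).
  by case: n => [|[|n]] //=; exact: measurable0.
have tF : trivIset setT (bigcup2 A (~` A)) by rewrite -trivIset_bigcup2 setICr.
have := @pvm_sigma_additive _ _ E _ mF tF u.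
rewrite EU => /(cvg_unique (@norm_hausdorff _ H)); apply.
apply: cvg_near_cst; near=> n.
have -> : n = n.-2.+2.
  by rewrite -[LHS](@subnK 2) ?addn2 ?subn2//; near: n; exists 2%N.
rewrite big_nat_recl// big_nat_recl//= big1 ?addr0// => i _.
exact: pvm0.
Unshelve. all: by end_near. Qed.

Lemma spectral_distribution_fin (A : Borel) u : (mu u A < +oo)%E.
Proof. exact: ltry. Qed.

Lemma spectral_distribution_setC u : mu u (~` `[- M, M]%classic) = 0%E.
Proof.
rewrite /spectral_distribution -[u in E _ u]EM -pvmI//; last exact: measurableC.
by rewrite setICl pvm0 linear0.
Qed.

Lemma spectral_integrable (f : R -> R) (A : Borel) u : measurable A ->
  measurable_fun setT f -> bounded_supp f ->
  (mu u).-integrable A (EFin \o f).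
Proof.
move=> mA mf bf; apply: (integrableS measurableT) => //.
have mfE : measurable_fun setT (EFin \o f) by exact/measurable_EFinP.
have mMC : measurable (~` `[- M, M]%classic : Borel) by exact: measurableC.
apply/(negligible_integrable mMC measurableT mfE (spectral_distribution_setC u)).
rewrite setDE setCK setTI; apply: measurable_bounded_integrable => //.
- exact: spectral_distribution_fin.
- exact: measurable_funTS.
- have [C fC] := bf; exists C; split; first exact: num_real.
  by move=> N CN x /fC /le_trans; apply; exact: ltW.
Qed.

(** The spectral distribution of E(A) u is that of u restricted to A. *)
Lemma spectral_integral_pvm (f : R -> R) (A : Borel) u : measurable A ->
  measurable_fun setT f -> bounded_supp f ->
  \int[mu (E A u)]_x f x = \int[mu u]_(x in A) f x.
Proof.
move=> mA mf bf; rewrite /Rintegral; congr fine.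
have mAC : measurable (~` A) by exact: measurableC.
have mu0 : mu (E A u) (~` A) = 0%E.
  rewrite spectral_distribution_pvm// setICr; exact: measure0.
rewrite (negligible_integral (N := ~` A)) //; first last.
- exact: spectral_integrable.
rewrite setDE setCK setTI; apply: eq_measure_integral => B mB BA.
rewrite [LHS]spectral_distribution_pvm// setIC.
by move/setIidPl : BA => ->.
Qed.

(** The formula for the form of T is additive under u = E(A) u + E(~A) u, while
    the form itself has a cross term; the cross term therefore vanishes, and
    what remains is the formula at E(A) u. *)
Lemma Re_inner_pvm (A : Borel) u : measurable A ->
  Rinner u (E A (T u)) = \int[mu u]_(x in A) x.
Proof.
move=> mA.
have mid : measurable_fun setT (fun x : R => x) by [].
have diag B : measurable B ->
    Rinner (E B u) (T (E B u)) = \int[mu u]_(x in B) x.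
  by move=> mB; rewrite ET/= spectral_integral_pvm//; exact: bounded_supp_id.
have mAC : measurable (~` A) by exact: measurableC.
have Eu := pvm_split u mA.
have ET0 : Rinner (E A u) (T (E (~` A) u)) = 0.
  have := ET u; rewrite {1 2}Eu (raddfD T).
  move/(congr1 (@complex.Re R)); rewrite Re_innerDl !Re_innerDr !diag//=.
  rewrite -[in RHS](setUv A) Rintegral_setU//; last first.
  - by rewrite disj_set2E setICr.
  - by rewrite setUv; apply: spectral_integrable => //; exact: bounded_supp_id.
  rewrite Re_spectral_sym Re_innerC.
  by lra.
by rewrite -pvm_sym {2}Eu (raddfD T) Re_innerDr ET0 addr0 diag.
Qed.

(** By polarization and [Re_inner_pvm], the difference of the spectral
    distributions of u + T u and u - T u is the signed measure with density 4x
    with respect to the one of u. *)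
Let ge0_spectral_integral_step (f : R -> R) u : measurable_fun setT f ->
  (forall x, 0 <= f x) -> bounded_supp f ->
  \int[mu (u + T u)]_x f x - \int[mu (u - T u)]_x f x =
  4 * \int[mu u]_x (f x * x).
Proof.
move=> mf f0 bf.
have mid : measurable_fun setT (fun x : R => x) by [].
(* The density 4x is split into its positive part gp and negative part gn. *)
pose gp (x : R) := 4 * Num.max x 0.
pose gn (x : R) := 4 * Num.max (- x) 0.
have mgp : measurable_fun setT gp.
  by apply: measurable_funM => //; exact: measurable_maxr.
have mgn : measurable_fun setT gn.
  apply: measurable_funM => //; exact: measurable_maxr.
have gp0 x : 0 <= gp x by rewrite mulr_ge0// le_max lexx orbT.
have gn0 x : 0 <= gn x by rewrite mulr_ge0// le_max lexx orbT.
have gpn x : gp x - gn x = 4 * x.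
  rewrite /gp /gn -mulrBr; congr (_ * _).
  by case: (leP 0 x) => x0; case: (leP 0 (- x)) => x1; lra.
have bgp : bounded_supp gp.
  exact/bounded_suppM/bounded_supp_maxr/bounded_supp_id.
have bgn : bounded_supp gn.
  exact/bounded_suppM/bounded_supp_maxr/bounded_suppN/bounded_supp_id.
have fin (h : R -> R) (A : Borel) v : measurable A -> measurable_fun setT h ->
    bounded_supp h ->
    (\int[mu v]_(x in A) h x)%:E = (\int[mu v]_(x in A) (h x)%:E)%E.
  move=> mA mh bh; rewrite /Rintegral fineK//.
  exact/integrable_fin_num/spectral_integrable.
have E1 (A : Borel) : measurable A ->
    (mu (u + T u)%R A + \int[mu u]_(x in A) (gn x)%:E =
     mu (u - T u)%R A + \int[mu u]_(x in A) (gp x)%:E)%E.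
  move=> mA; rewrite -!fin// /spectral_distribution -!EFinD; congr EFin.
  rewrite spectral_distribution_polar Re_inner_pvm//.
  rewrite -RintegralZl//; last first.
    by apply: spectral_integrable => //; exact: bounded_supp_id.
  under [X in _ + X + _ = _]eq_Rintegral do rewrite -gpn.
  rewrite RintegralB//; [ring|exact: spectral_integrable..].
have := @integral_add_density _ (measurableTypeR R) R
  (mu (u + T u)) (mu (u - T u)) (mu u) gn gp f mgn gn0 mgp gp0 E1 mf f0.
have mfp : measurable_fun setT (fun x => f x * gp x) by exact: measurable_funM.
have mfn : measurable_fun setT (fun x => f x * gn x) by exact: measurable_funM.
rewrite -!fin//; [|exact: bounded_suppM..].
rewrite -!EFinD => -[] E2.
rewrite -RintegralZl//; last first.
  apply: spectral_integrable => //; first exact: measurable_funM.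
  by apply: bounded_suppM => //; exact: bounded_supp_id.
under [RHS]eq_Rintegral => x _ do rewrite mulrCA -gpn mulrBr.
rewrite RintegralB//;
  [by lra|by apply: spectral_integrable => //; exact: bounded_suppM..].
Qed.

Lemma spectral_integral_step (f : R -> R) u : measurable_fun setT f ->
  bounded_supp f ->
  \int[mu (u + T u)]_x f x - \int[mu (u - T u)]_x f x =
  4 * \int[mu u]_x (f x * x).
Proof.
move=> mf bf.
pose fp x := Num.max (f x) 0; pose fn x := Num.max (- f x) 0.
have fpn x : f x = fp x - fn x.
  by rewrite /fp /fn; case: (leP 0 (f x)) => x0; case: (leP 0 (- f x)) => x1; lra.
have mfp : measurable_fun setT fp by exact: measurable_maxr.
have mfn : measurable_fun setT fn.
  by apply: measurable_maxr => //; exact: measurable_funN.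
have fp0 x : 0 <= fp x by rewrite le_max lexx orbT.
have fn0 x : 0 <= fn x by rewrite le_max lexx orbT.
have bfp : bounded_supp fp by exact: bounded_supp_maxr.
have bfn : bounded_supp fn by exact/bounded_supp_maxr/bounded_suppN.
have := ge0_spectral_integral_step u mfp fp0 bfp.
have := ge0_spectral_integral_step u mfn fn0 bfn.
have split v : \int[mu v]_x f x = \int[mu v]_x fp x - \int[mu v]_x fn x.
  rewrite -RintegralB//; [|exact: spectral_integrable..].
  by apply: eq_Rintegral => x _; exact: fpn.
have -> : \int[mu u]_x (f x * x) =
    \int[mu u]_x (fp x * x) - \int[mu u]_x (fn x * x).
  rewrite -RintegralB//; last 2 first.
  - by apply: spectral_integrable => //;
      [exact: measurable_funM|exact: bounded_suppM].
  - by apply: spectral_integrable => //;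
      [exact: measurable_funM|exact: bounded_suppM].
  by apply: eq_Rintegral => x _; rewrite -mulrBl -fpn.
rewrite !split; lra.
Qed.

(** Each step trades a factor x under the integral for an application of T,
    through [spectral_integral_step]; polarizing the induction hypothesis turns
    the two moments of order n at u + T u and u - T u into <u, T^(n+1) u>. *)
Lemma moment_spectral_distribution n u :
  moment (mu u) n = Rinner u (iter n T u).
Proof.
elim: n u => [|n IH] u.
  rewrite /moment; under eq_Rintegral do rewrite expr0.
  rewrite Rintegral_cst//= /spectral_distribution mul1r.
  by rewrite (_ : E _ u = u)//; exact: pvmT.
have iterD k v w : iter k T (v + w) = iter k T v + iter k T w.
  by elim: k => //= k ->; rewrite raddfD.
have iterN k v : iter k T (- v) = - iter k T v.
  by elim: k => //= k ->; rewrite raddfN.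
have sym k v w : Rinner v (iter k T w) = Rinner (iter k T v) w.
  elim: k v => // k IHk v.
  by rewrite [iter _ _ w]iterS Re_spectral_sym IHk -iterSr.
have mX : measurable_fun setT (fun x : R => x ^+ n) by exact: measurable_funX.
have := spectral_integral_step u mX (bounded_suppX n).
rewrite -!/(moment _ _).
rewrite !IH !iterD !iterN !Re_innerDl !Re_innerDr !Re_innerNl !Re_innerNr.
rewrite (sym n (T u) u) (Re_innerC _ u) -iterSr => E1.
rewrite /moment; under eq_Rintegral do rewrite exprSr.
by lra.
Qed.

End spectral_moments.

(** * Powers of tridiagonal operators *)

(** Coordinate k of J^n delta_0, for the tridiagonal operator
    (J y)_k = al_k y_k + b_k y_(k-1) + d_k y_(k+1). Since 0.-1 = 0, b_0 would be
    added to al_0; every use below has b_0 = 0. *)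
Fixpoint jacobi_pow (R : comPzRingType) (al b d : nat -> R) (n k : nat) : R :=
  if n is n'.+1 then al k * jacobi_pow al b d n' k +
    b k * jacobi_pow al b d n' k.-1 + d k * jacobi_pow al b d n' k.+1
  else (k == 0%N)%:R.

(** * Chebyshev polynomials *)

Section chebyshev.
Variables (R : realFieldType) (m v : R).

Let s : {poly R} := 'X - m%:P.
Let D : {poly R} := v%:P *+ 4 - s ^+ 2.

(** The monic orthogonal polynomials of the semicircle law of mean m and
    variance v, i.e. rescaled Chebyshev polynomials of the second kind. *)
Fixpoint chebyshevU (n : nat) : {poly R} :=
  match n with
  | 0%N => 1
  | 1%N => 'X - m%:P
  | (n''.+1 as n').+1 => ('X - m%:P) * chebyshevU n' - v%:P * chebyshevU n''
  end.
Local Notation U := chebyshevU.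

Lemma chebyshevUSS n : U n.+2 = s * U n.+1 - v%:P * U n.
Proof. by []. Qed.

Lemma chebyshevU_mulX n :
  'X * U n = m%:P * U n + (if n is 0%N then 0 else v)%:P * U n.-1 + U n.+1.
Proof.
case: n => [|n]; first by rewrite /=; ring.
by rewrite chebyshevUSS /s/=; ring.
Qed.

Let D_deriv : D^`() = - 2 * s.
Proof.
rewrite /D derivB derivMn derivC /s expr2 derivM derivB derivX derivC; ring.
Qed.

(** These first-order relations are proved together because the recurrence for
    the first one consumes the second one. *)
Lemma chebyshevU_deriv n :
  D * (U n.+1)^`() = 2 * v%:P * n.+2%:R * U n - n.+1%:R * s * U n.+1 /\
  D * (U n)^`() = n.+2%:R * s * U n - 2 * n.+1%:R * U n.+1.
Proof.
have DE : D = 4 * v%:P - s ^+ 2 by rewrite /D mulr_natl.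
have s1 : s^`() = 1 by rewrite /s derivB derivX derivC subr0.
elim: n => [|n [IHA IHB]].
  rewrite /= -/s s1 derivC DE; split; ring.
have dU : (U n.+2)^`() = U n.+1 + s * (U n.+1)^`() - v%:P * (U n)^`().
  by rewrite chebyshevUSS derivB !derivM s1 derivC; ring.
split; last first.
  by rewrite IHA chebyshevUSS; ring.
have -> : D * (U n.+2)^`() = D * U n.+1 + s * (D * (U n.+1)^`())
   - v%:P * (D * (U n)^`()) by rewrite dU; ring.
by rewrite IHA IHB chebyshevUSS DE; ring.
Qed.

(** Chebyshev's differential equation, by differentiating the first relation of
    [chebyshevU_deriv], multiplying by D and eliminating the derivative of the
    preceding polynomial. *)
Lemma chebyshevU_ode n : v != 0 ->
  D * (U n)^`()^`() - 3 * s * (U n)^`() + (n * n.+2)%:R * U n = 0.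
Proof.
move=> v0; case: n => [|k].
  by rewrite /= !derivC; ring.
have DE : D = 4 * v%:P - s ^+ 2 by rewrite /D mulr_natl.
have s1 : s^`() = 1 by rewrite /s derivB derivX derivC subr0.
have D0 : D != 0.
  apply: contra_neq v0 => /(congr1 (fun p => p.[m])).
  rewrite /D /s !hornerE subrr expr0n/= subr0 => v4.
  by lra.
have [A B] := chebyshevU_deriv k.
have := congr1 deriv A.
have natP j : (j%:R : {poly R})^`() = 0 by rewrite -polyC_natr derivC.
rewrite derivM D_deriv derivB !derivM s1 !natP derivC => A'.
apply: (mulfI D0); rewrite mulr0.
set V := U k.+1 in A B A' *; set W := U k in A B A' *.
have -> : D * (D * V^`()^`() - 3 * s * V^`() + (k.+1 * k.+3)%:R * V) =
  D * (- 2 * s * V^`() + D * V^`()^`())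
  + D * (- s * V^`() + (k.+1 * k.+3)%:R * V).
  by ring.
rewrite A'.
transitivity (k.+2%:R *
  (k.+1%:R * V * D - s * (D * V^`()) + 2 * v%:P * (D * W^`()))).
  by rewrite natrM; ring.
by rewrite A B DE; ring.
Qed.

End chebyshev.

(** * Moments of the semicircle law *)

Section semicircle_moments.
Variables (R : realType) (m v : R).
Hypothesis v0 : 0 < v.

Let F (t : R) : R := m + 2 * Num.sqrt v * sin t.
Let J : set (measurableTypeR R) := `[- (pi / 2), pi / 2]%classic.

Let measurable_J : measurable J.
Proof. exact: measurable_itv. Qed.

Let pihalf_lt : - (pi / 2) < pi / 2 :> R.
Proof. by rewrite ltrNl; have := @pi_gt0 R; lra. Qed.

Let F_derive (t : R) : is_derive t 1 F (2 * Num.sqrt v * cos t).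
Proof. by rewrite /F; apply: trigger_derive; rewrite /GRing.scale/=; ring. Qed.

Let continuous_F : continuous F.
Proof. by move=> t; apply/differentiable_continuous/derivable1_diffP. Qed.

Let continuous_weight (p : {poly R}) : continuous (fun t => p.[F t] * cos t ^+ 2).
Proof.
move=> t; apply: cvgM.
  apply: continuous_comp; [exact: continuous_F|exact: continuous_horner].
exact: (cvgM (@continuous_cos R t) (@continuous_cos R t)).
Qed.

(** Integration against the semicircle law after the substitution
    x = m + 2 sqrt v sin t, which turns the square root of the density into a
    smooth weight on a closed interval. *)
Definition semicircle_form (p : {poly R}) : R :=
  2 / pi * \int[lebesgue_measure]_(t in J) (p.[F t] * cos t ^+ 2).
Local Notation L := semicircle_form.

Let integrable_weight (p : {poly R}) : (@lebesgue_measure R).-integrable J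
  (EFin \o (fun t => p.[F t] * cos t ^+ 2)).
Proof.
apply: continuous_compact_integrable; first exact: segment_compact.
exact: continuous_subspaceT.
Qed.

Lemma semicircle_formD p q : L (p + q) = L p + L q.
Proof.
rewrite /semicircle_form -mulrDr; congr (_ * _).
rewrite -(RintegralD measurable_J (integrable_weight p) (integrable_weight q)).
by apply: eq_Rintegral => t _; rewrite hornerD mulrDl.
Qed.

Lemma semicircle_formCM c p : L (c%:P * p) = c * L p.
Proof.
rewrite /semicircle_form mulrCA; congr (_ * _).
rewrite -(RintegralZl _ measurable_J (integrable_weight p)).
by apply: eq_Rintegral => t _; rewrite hornerM hornerC -mulrA.
Qed.

Let FTC (G g : R -> R) : (forall t : R, is_derive t 1 G (g t)) -> continuous g ->
  \int[lebesgue_measure]_(t in J) g t = G (pi / 2) - G (- (pi / 2)).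
Proof.
move=> dG cg; rewrite /Rintegral (@continuous_FTC2 _ g G)//.
- exact: continuous_subspaceT.
- have cG : continuous G.
    by move=> t; apply/differentiable_continuous/derivable1_diffP.
  split; first by move=> x _.
  + exact/cvg_at_right_filter/cG.
  + exact/cvg_at_left_filter/cG.
- by move=> t _; rewrite derive1E derive_val.
Qed.

Lemma semicircle_form1 : L 1 = 1.
Proof.
rewrite /semicircle_form.
under eq_Rintegral do rewrite hornerC mul1r.
have dG (t : R) : is_derive t 1 (fun t => (t + sin t * cos t) / 2) (cos t ^+ 2).
  apply: trigger_derive; rewrite /GRing.scale/=.
  have E := cos2Dsin2 t.
  have -> : cos t ^+ 2 = (1 + cos t ^+ 2 - sin t ^+ 2) / 2 by rewrite -{1}E; field.
  by field.
have cG : continuous (fun t : R => cos t ^+ 2).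
  by move=> t; exact: (cvgM (@continuous_cos R t) (@continuous_cos R t)).
rewrite (FTC dG cG) sinN cosN cos_pihalf sin_pihalf.
by move: (@pi R) (lt0r_neq0 (@pi_gt0 R)) => q q0; field.
Qed.

Let sin_cos t : Num.sqrt v ^+ 2 * sin t ^+ 2 = v - v * cos t ^+ 2.
Proof.
rewrite sqr_sqrtr ?(ltW v0)// -[X in X - _]mulr1 -(cos2Dsin2 t); ring.
Qed.

(** Integration by parts: the integrand is the derivative of
    2 sqrt v p(F t) cos^3 t, which vanishes at both ends. *)
Lemma semicircle_form_ibp p :
  L ((v%:P *+ 4 - ('X - m%:P) ^+ 2) * p^`() - 3 * ('X - m%:P) * p) = 0.
Proof.
set q := (X in L X).
have dG (t : R) : is_derive t 1 (fun t => 2 * Num.sqrt v * (p.[F t] * cos t ^+ 3))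
    (q.[F t] * cos t ^+ 2).
  have dpF : is_derive t 1 (fun t => p.[F t])
      (p^`().[F t] * (2 * Num.sqrt v * cos t)).
    exact: is_derive1_comp.
  apply: trigger_derive; rewrite /GRing.scale/= /q !hornerE /F.
  have := sin_cos t.
  set a := Num.sqrt v; set P := p.[_]; set P' := p^`().[_] => E.
  have E2 : a ^+ 2 = v by rewrite sqr_sqrtr// ltW.
  transitivity (4 * a ^+ 2 * cos t ^+ 4 * P' - 6 * a * sin t * P * cos t ^+ 2).
    by rewrite /=; ring.
  have -> : 4 * a ^+ 2 * cos t ^+ 4 * P' =
      (4 * v - 4 * (a ^+ 2 * sin t ^+ 2)) * cos t ^+ 2 * P'.
    by rewrite E E2; ring.
  by rewrite /=; ring.
rewrite /semicircle_form (FTC dG (@continuous_weight q)) cosN cos_pihalf.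
by rewrite !expr0n/= !mulr0 subrr mulr0.
Qed.

Lemma moment_semicircle_form n : moment (semicircle m v) n = L 'X^n.
Proof.
pose a := Num.sqrt v.
have a0 : 0 < a by rewrite sqrtr_gt0.
have a2 : a ^+ 2 = v by rewrite sqr_sqrtr// ltW.
pose G x := x ^+ n * ((2 * pi * v)^-1 * Num.sqrt (4 * v - (x - m) ^+ 2)).
have cG : continuous G.
  move=> x; apply: cvgM; first exact: exprn_continuous.
  apply: cvgM; first exact: cvg_cst.
  apply: (@continuous_comp _ _ _ (fun x => 4 * v - (x - m) ^+ 2) Num.sqrt);
    last exact: sqrt_continuous.
  apply: cvgB; first exact: cvg_cst.
  have cXm : {for x, continuous (fun x => x - m)}.
    by apply: cvgB => //; exact: cvg_cst.
  exact: (cvgM cXm cXm).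
have F' : F^`()%classic = (fun t => 2 * a * cos t).
  by apply/funext => t; rewrite derive1E derive_val add0r mul1r.
have cF' : continuous F^`()%classic.
  by rewrite F' => t; apply: cvgM; [exact: cvg_cst|exact: continuous_cos].
have Fl : F (- (pi / 2)) = m - 2 * a by rewrite /F sinN sin_pihalf mulrN1.
have Fr : F (pi / 2) = m + 2 * a by rewrite /F sin_pihalf mulr1.
have mX : measurable_fun setT (fun x : R => x ^+ n) by exact: measurable_funX.
rewrite /moment /Rintegral (@integral_density _ (measurableTypeR R) R
  (semicircle m v) (@lebesgue_measure R) (semicircle_pdf m v) _
  (@measurable_semicircle_pdf R m v) (@semicircle_pdf_ge0 R m v)
  (fun A mA => erefl) mX).
transitivity (fine (\int[lebesgue_measure]_(x in
    `[F (- (pi / 2)), F (pi / 2)]) (G x)%:E)).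
  congr fine; rewrite Fl Fr [RHS]integral_mkcond; apply: eq_integral => x _.
  rewrite patchE /semicircle_pdf indicE /G.
  by case: ifPn => _; rewrite ?mulr1 ?mulr0.
rewrite integration_by_substitution_increasing//; first last.
- exact: continuous_subspaceT.
- split; first by move=> x _.
  + exact/cvg_at_right_filter/continuous_F.
  + exact/cvg_at_left_filter/continuous_F.
- by apply/cvg_ex; eexists; exact/cvg_at_left_filter/cF'.
- by apply/cvg_ex; eexists; exact/cvg_at_right_filter/cF'.
- by move=> x y xJ yJ xy; rewrite /F ltrD2l ltr_pM2l ?mulr_gt0// ltr_sin.
- exact: ltW.
rewrite /semicircle_form -(RintegralZl _ measurable_J (integrable_weight 'X^n)).
rewrite /Rintegral; congr fine; apply: eq_integral => t.
rewrite inE/= in_itv/= => tJ.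
have ct : 0 <= cos t by rewrite cos_ge0_pihalf.
rewrite F' hornerXn.
change ((G (F t) * (2 * a * cos t))%:E = (2 / pi * (F t ^+ n * cos t ^+ 2))%:E).
congr EFin; rewrite /G.
have -> : 4 * v - (F t - m) ^+ 2 = (2 * a * cos t) ^+ 2.
  have -> : (F t - m) ^+ 2 = 4 * (a ^+ 2 * sin t ^+ 2) by rewrite /F -/a; ring.
  by rewrite sin_cos -a2; ring.
rewrite sqrtr_sqr ger0_norm ?mulr_ge0// ?(ltW a0)//.
rewrite -a2.
have := lt0r_neq0 a0; move: (@pi R) (lt0r_neq0 (@pi_gt0 R)) => q q0 a0'.
by field; rewrite a0' q0.
Qed.

(** Chebyshev's equation says that n (n + 2) U_n has the form killed by
    [semicircle_form_ibp], with p the derivative of U_n. *)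
Lemma semicircle_form_chebyshev n : L (chebyshevU m v n) = (n == 0%N)%:R.
Proof.
case: n => [|n]; first exact: semicircle_form1.
have := semicircle_form_ibp (chebyshevU m v n.+1)^`().
have := chebyshevU_ode m n.+1 (lt0r_neq0 v0).
set P := (X in L X = 0); set U := chebyshevU _ _ _.
move=> E; have -> : P = (- (n.+1 * n.+3)%:R)%:P * U.
  by rewrite polyCN polyC_natr mulNr -[RHS]add0r -E addrK.
rewrite semicircle_formCM => /eqP; rewrite mulf_eq0 oppr_eq0 pnatr_eq0/=.
by move=> /eqP.
Qed.

(** Orthogonality makes the functional p |-> L(p U_k) at p = 1 equal to delta_0,
    and the three-term recurrence makes multiplication by X act as the constant
    Jacobi operator. *)
Lemma moment_semicircle n : moment (semicircle m v) n =
  jacobi_pow (fun=> m) (fun k => if k is 0%N then 0 else v) (fun=> 1) n 0.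
Proof.
have key k : L ('X^n * chebyshevU m v k) =
    jacobi_pow (fun=> m) (fun k => if k is 0%N then 0 else v) (fun=> 1) n k.
  elim: n k => [|n IH] k; first by rewrite mul1r semicircle_form_chebyshev.
  rewrite exprSr -mulrA chebyshevU_mulX !mulrDr !semicircle_formD.
  by rewrite !(mulrCA 'X^n) !semicircle_formCM !IH [RHS]/= mul1r.
by rewrite -key mulr1 moment_semicircle_form.
Qed.

End semicircle_moments.

(** * Series of complex numbers *)

Lemma half_le_norm_1B (F : numFieldType) (w : F) :
  `|w| <= 2^-1 -> 2^-1 <= `|1 - w|.
Proof.
move=> w2; have half : 2^-1 + 2^-1 = 1 :> F.
  by rewrite -mulr2n -[LHS]mulr_natl mulfV// pnatr_eq0.
rewrite -(lerD2r 2^-1) half -[leLHS]normr1 -[X in `|X|](subrK w).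
by apply: le_trans (ler_normD _ _) _; rewrite lerD2l.
Qed.

Section complex_series.
Variable R : realType.
Local Notation C := (R[i]^o).

Lemma normc_real (x : R) : `|x%:C| = `|x|%:C :> R[i].
Proof. by rewrite normc_def/= expr0n addr0 sqrtr_sqr. Qed.

Lemma cvg_half_bound (u : nat -> C) (l : C) (B : R[i]) :
  (forall N, `|l - u N| <= B / 2 ^+ N) -> u @ \oo --> l.
Proof.
move=> uB; apply/cvgrPdist_lt => e e0.
have B0 : 0 <= B by have := le_trans (normr_ge0 _) (uB 0%N); rewrite expr0 divr1.
have BE : B = (complex.Re B)%:C by rewrite RRe_real// ger0_real.
set b := complex.Re B in BE.
have eE : e = (complex.Re e)%:C by rewrite RRe_real// gtr0_real.
rewrite eE ltcR in e0 *.
have /cvgrPdist_lt/(_ _ e0) : (fun N => b / 2 ^+ N) @ \oo --> (0 : R).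
  have -> : (fun N => b / 2 ^+ N) = geometric b 2^-1.
    by apply/funext => N /=; rewrite exprVn.
  by apply: cvg_geometric; rewrite ger0_norm// invf_lt1 ?ltr1n.
apply: filterS => N; rewrite sub0r normrN => BN.
apply: le_lt_trans (uB N) _.
rewrite BE -(rmorph_nat (real_complex R) 2) -rmorphXn -fmorphV -rmorphM ltcR.
exact: le_lt_trans (ler_norm _) BN.
Qed.

Lemma cvg_sum_from1 (f : nat -> C) (l : C) :
  (fun N => \sum_(0 <= n < N) f n) @ \oo --> l ->
  (fun N => \sum_(1 <= n < N) f n) @ \oo --> l - f 0%N.
Proof.
move=> /cvgrPdist_lt fl; apply/cvgrPdist_lt => e e0; near=> N.
have N1 : (0 < N)%N by near: N; exists 1%N.
have -> : l - f 0%N - \sum_(1 <= n < N) f n = l - \sum_(0 <= n < N) f n.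
  by rewrite [in RHS]big_ltn// opprD addrA.
by near: N; exact: fl.
Unshelve. all: by end_near. Qed.

Lemma cvg_geometric_half (z w : C) : `|w| <= 2^-1 ->
  (fun N => \sum_(0 <= n < N) z * w ^+ n) @ \oo --> z / (1 - w).
Proof.
move=> w2.
have h := half_le_norm_1B w2.
have w1 : 1 - w != 0.
  by rewrite -normr_gt0; apply: lt_le_trans h; rewrite invr_gt0.
have sumE N : z / (1 - w) - \sum_(0 <= n < N) z * w ^+ n = z * w ^+ N / (1 - w).
  elim: N => [|N IH]; first by rewrite big_nil expr0; field.
  by rewrite big_nat_recr//= opprD addrA IH exprS; field.
apply: (@cvg_half_bound _ _ (`|z| * 2)) => N.
rewrite sumE !normrM normfV normrX -exprVn.
rewrite mulrAC ler_pM ?mulr_ge0 ?invr_ge0 ?exprn_ge0//.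
  by rewrite ler_wpM2l// -[leRHS]invrK lef_pV2// ?qualifE/= ?normr_gt0// invr_gt0.
by rewrite lerXn2r// ?qualifE/= ?invr_ge0.
Qed.

(** The Neumann series for y = delta_0 + z J y: any bounded solution has
    coordinate 0 equal to the generating series of the <delta_0, J^n delta_0>.
    So the series is summed by exhibiting a bounded solution, which also gives
    its convergence. *)
Lemma jacobi_resolvent (al b d : nat -> R) (K Y : R[i]) (z : C) (y : nat -> C) :
  (forall k, (`|al k| + `|b k| + `|d k|)%:C <= K) -> `|z| * K <= 2^-1 ->
  (forall k, `|y k| <= Y) ->
  (forall k, y k = (k == 0%N)%:R +
     z * ((al k)%:C * y k + (b k)%:C * y k.-1 + (d k)%:C * y k.+1)) ->
  (fun N => \sum_(0 <= n < N) (jacobi_pow al b d n 0)%:C * z ^+ n : C)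
    @ \oo --> y 0%N.
Proof.
move=> abdK zK yY yE.
suff H N k : `|y k - \sum_(0 <= n < N) (jacobi_pow al b d n k)%:C * z ^+ n|
    <= Y / 2 ^+ N by apply: (@cvg_half_bound _ _ Y) => N; exact: H.
elim: N k => [|N IH] k; first by rewrite big_nil subr0 expr0 divr1.
pose S k := \sum_(0 <= n < N) (jacobi_pow al b d n k)%:C * z ^+ n.
have -> : y k - \sum_(0 <= n < N.+1) (jacobi_pow al b d n k)%:C * z ^+ n =
   z * ((al k)%:C * (y k - S k) + (b k)%:C * (y k.-1 - S k.-1) +
        (d k)%:C * (y k.+1 - S k.+1)).
  rewrite {1}yE big_nat_recl//= expr0 mulr1.
  rewrite (_ : \sum_(0 <= i < N) _ =
     z * ((al k)%:C * S k + (b k)%:C * S k.-1 + (d k)%:C * S k.+1)); last first.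
    rewrite /S !mulr_sumr -!big_split mulr_sumr/=; apply: eq_bigr => n _.
    by rewrite !rmorphD !rmorphM exprS; ring.
  by rewrite rmorph_nat; ring.
set e := Y / 2 ^+ N in IH.
have e0 : 0 <= e by apply: le_trans (IH 0%N).
rewrite normrM.
have -> : Y / 2 ^+ N.+1 = 2^-1 * e by rewrite /e exprS invfM mulrCA.
apply: le_trans (_ : `|z| * (K * e) <= _); last first.
  by rewrite mulrA ler_wpM2r.
rewrite ler_wpM2l//.
apply: le_trans (_ : (`|al k| + `|b k| + `|d k|)%:C * e <= _); last first.
  by rewrite ler_wpM2r.
rewrite !rmorphD/= !mulrDl -!normc_real.
apply: le_trans (ler_normD _ _) _; apply: lerD.
  apply: le_trans (ler_normD _ _) _; rewrite !normrM.
  by apply: lerD; exact: ler_wpM2l.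
by rewrite normrM; exact: ler_wpM2l.
Qed.

End complex_series.

(** * Uniqueness of power series coefficients *)

Section power_series_uniqueness.
Variable R : realType.

(** If D_k is the first possibly nonzero coefficient, the partial sums are
    D_k t^k up to O(t^(k+1)), uniformly in the number of terms. *)
Lemma power_series0_real (D : nat -> R) :
  (forall t, 0 < t <= 1 ->
    (fun N => \sum_(0 <= n < N) D n * t ^+ n) @ \oo --> (0 : R)) ->
  forall n, D n = 0.
Proof.
move=> D0.
have [B B0 BD] : exists2 B, 0 < B & forall n, `|D n| <= B.
  have h1 : 0 < (1 : R) <= 1 by rewrite ltr01 lexx.
  have /cvgrPdist_lt/(_ 1 ltr01)[N0 _ H] := D0 1 h1.
  exists (2 + \sum_(0 <= i < N0) `|D i|) => [|n].
    by rewrite ltr_pwDl// sumr_ge0.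
  have [nN|Nn] := ltnP n N0.
    rewrite (big_cat_nat (leq0n n) (ltnW nN))/= (big_ltn nN).
    apply: le_trans (_ : `|D n| + 0 <= _); first by rewrite addr0.
    have : 0 <= \sum_(0 <= i < n) `|D i| by rewrite sumr_ge0.
    have : 0 <= \sum_(n.+1 <= i < N0) `|D i| by rewrite sumr_ge0.
    lra.
  have := H n Nn; have := H n.+1 (leqW Nn).
  rewrite !sub0r !normrN big_nat_recr//= expr1n mulr1.
  set S := \sum_(0 <= i < n) _ => S1 S0.
  have -> : D n = (S + D n) - S by rewrite addrC addKr.
  apply: le_trans (ler_normB _ _) _.
  have : 0 <= \sum_(0 <= i < N0) `|D i| by rewrite sumr_ge0.
  lra.
move=> n; elim/ltn_ind: n => k IH.
have tail t N : 0 < t <= 2^-1 ->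
    `|\sum_(0 <= n < k.+1 + N) D n * t ^+ n - D k * t ^+ k|
      <= 2 * B * (t ^+ k.+1 - t ^+ (k.+1 + N)).
  move=> /andP[t0 t2]; elim: N => [|N IHN].
    rewrite addn0 subrr mulr0 big_nat_recr//= big_nat_cond big1 ?add0r ?subrr ?normr0//.
    by move=> i /andP[/andP[_ ik] _]; rewrite IH// mul0r.
  rewrite addnS big_nat_recr//= addrAC.
  apply: le_trans (ler_normD _ _) _.
  apply: le_trans (lerD IHN (_ : _ <= B * t ^+ (k.+1 + N))) _.
    by rewrite normrM (ger0_norm (exprn_ge0 _ (ltW t0))) ler_wpM2r// exprn_ge0// ltW.
  rewrite (exprS t (k.+1 + N)); set T := t ^+ (k.+1 + N).
  have T0 : 0 <= B * T by rewrite mulr_ge0 ?ltW// exprn_gt0.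
  have : B * T * t <= B * T * 2^-1 by rewrite ler_wpM2l.
  lra.
have small t : 0 < t <= 2^-1 -> `|D k| <= 3 * B * t.
  move=> /andP[t0 t2].
  have tk0 : 0 < t ^+ k by rewrite exprn_gt0.
  rewrite -(ler_pM2r tk0) -(mulrA (3 * B)) -exprS.
  have Bt0 : 0 < B * t ^+ k.+1 by rewrite mulr_gt0 ?exprn_gt0.
  have t1 : 0 < t <= 1 by rewrite t0 (le_trans t2)// invf_le1// ler1n.
  have /cvgrPdist_lt/(_ _ Bt0)[N0 _ H] := D0 t t1.
  have := H (k.+1 + N0)%N (leq_addl _ _); rewrite /= sub0r normrN => S1.
  have t12 : 0 < t <= 2^-1 by rewrite t0.
  have := tail t N0 t12.
  set S := \sum_(0 <= n < _) _ in S1 *.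
  have -> : `|D k| * t ^+ k = `|D k * t ^+ k|.
    by rewrite normrM (ger0_norm (ltW tk0)).
  have : 0 <= B * t ^+ (k.+1 + N0) by rewrite mulr_ge0 ?ltW// exprn_gt0.
  have := ler_normB S (S - D k * t ^+ k); rewrite opprB addrCA subrr addr0.
  lra.
apply/eqP; rewrite -normr_eq0 eq_le normr_ge0 andbT.
apply/ler_addgt0Pr => e e0; rewrite add0r.
pose t := Num.min 2^-1 (e / (3 * B + 1)).
have d0 : 0 < 3 * B + 1 by lra.
have t0 : 0 < t by rewrite lt_min invr_gt0 ltr0n divr_gt0.
have /small : 0 < t <= 2^-1 by rewrite t0 ge_min lexx.
move/le_trans; apply.
have : (3 * B + 1) * t <= e.
  by rewrite mulrC -ler_pdivlMr// ge_min lexx orbT.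
lra.
Qed.

(** The disk where the series converges is rescaled so that the unit interval of
    [power_series0_real] corresponds to half of its radius. *)
Lemma power_series0 (d : nat -> R) :
  (\forall z \near (0 : R[i]^o),
     (fun N => \sum_(0 <= n < N) (d n)%:C * z ^+ n : R[i]^o) @ \oo -->
       (0 : R[i]^o)) ->
  forall n, d n = 0.
Proof.
move=> /nbhs_norm0P[e /= e0 H].
have eE : e = (complex.Re e)%:C by rewrite RRe_real// gtr0_real.
set e' := complex.Re e in eE; rewrite eE ltcR in e0.
have cvg_real t : 0 < t <= 1 ->
    (fun N => \sum_(0 <= n < N) d n * (e' / 2) ^+ n * t ^+ n) @ \oo --> (0 : R).
  move=> /andP[t0 t1].
  have : `|(e' / 2 * t)%:C| < e.
    rewrite normc_real eE ltcR ger0_norm ?mulr_ge0 ?(ltW t0) ?invr_ge0 ?(ltW e0)//.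
    have : e' / 2 * t <= e' / 2 by rewrite ler_piMr// divr_ge0// ltW.
    lra.
  move=> /H /cvgrPdist_lt cz; apply/cvgrPdist_lt => h h0.
  have h0' : 0 < h%:C by rewrite ltcR.
  move: (cz _ h0'); apply: filterS => N.
  rewrite !sub0r !normrN -ltcR -normc_real => hN.
  congr (`|_| < _) : hN.
  rewrite rmorph_sum; apply: eq_bigr => n _.
  by rewrite -rmorphXn -rmorphM exprMn mulrA.
have := power_series0_real cvg_real.
move=> E n; apply/eqP; have /eqP := E n.
by rewrite mulf_eq0 expf_eq0 (gt_eqF (_ : 0 < e' / 2)) ?divr_gt0// andbF orbF.
Qed.

Lemma power_series_inj (a b : nat -> R) (f : R[i]^o -> R[i]^o) :
  (\forall z \near (0 : R[i]^o),
     (fun N => \sum_(0 <= n < N) (a n)%:C * z ^+ n : R[i]^o) @ \oo --> f z) ->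
  (\forall z \near (0 : R[i]^o),
     (fun N => \sum_(0 <= n < N) (b n)%:C * z ^+ n : R[i]^o) @ \oo --> f z) ->
  forall n, a n = b n.
Proof.
move=> az bz n; apply/eqP; rewrite -subr_eq0; apply/eqP.
apply: (@power_series0 (fun n => a n - b n)).
move: az bz; apply: filterS2 => z /cvgrPdist_lt za /cvgrPdist_lt zb.
apply/cvgrPdist_lt => e e0.
have e20 : 0 < e / 2 by rewrite divr_gt0.
move: (za _ e20) (zb _ e20); apply: filterS2 => N aN bN.
rewrite sub0r normrN (splitr e).
have -> : \sum_(0 <= k < N) (a k - b k)%:C * z ^+ k =
    (f z - \sum_(0 <= k < N) (b k)%:C * z ^+ k)
    - (f z - \sum_(0 <= k < N) (a k)%:C * z ^+ k).
  rewrite opprB addrC addrA subrK -sumrB.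
  by apply: eq_bigr => k _; rewrite rmorphB mulrBl.
by apply: le_lt_trans (ler_normB _ _) _; apply: ltrD.
Qed.

End power_series_uniqueness.

(** * Moment series of the semicircle law *)

(** The root is written as 2 / (A + S), with S a square root of the
    discriminant, so that it makes sense at z = 0. The sign of S is chosen by
    comparing norms: this bounds the root without continuity of the square
    root. *)
Lemma quadratic_root (R : rcfType) (m v z : R[i]) : `|m * z| <= 2^-1 ->
  exists G, G = 1 + m * z * G + v * z ^+ 2 * G ^+ 2 /\ `|G| <= 4.
Proof.
move=> mz.
pose A := 1 - m * z; pose S := sqrtC (A ^+ 2 - 4 * v * z ^+ 2).
have SE : S ^+ 2 = A ^+ 2 - 4 * v * z ^+ 2 by rewrite sqrtCK.
have A2 : 2^-1 <= `|A| := half_le_norm_1B mz.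
wlog AS : S SE / `|A| <= `|A + S|.
  have [AS|] := boolP (`|A| <= `|A + S|); first by move/(_ S SE AS).
  rewrite -real_ltNge ?normr_real// => /ltW AS.
  move=> /(_ (- S)); apply; first by rewrite sqrrN.
  have := ler_normD (A + S) (A - S).
  rewrite addrACA subrr addr0 -mulr2n normrMn mulr2n.
  move=> /le_trans/(_ (lerD AS (lexx _))).
  by rewrite lerD2l.
have AS2 : 2^-1 <= `|A + S| := le_trans A2 AS.
have AS0 : A + S != 0 by rewrite -normr_gt0 (lt_le_trans _ AS2)// invr_gt0.
exists (2 / (A + S)); split.
  have -> : m * z = 1 - A by rewrite /A opprB addrC subrK.
  apply/eqP; rewrite -subr_eq0; apply/eqP.
  transitivity ((A ^+ 2 - 4 * v * z ^+ 2 - S ^+ 2) / (A + S) ^+ 2 ).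
    by field.
  by rewrite SE subrr mul0r.
rewrite normrM normfV normr_nat ler_pdivrMr ?normr_gt0//.
apply: le_trans (_ : 4 * 2^-1 <= _); last by rewrite ler_wpM2l.
by rewrite (natrM R[i] 2 2) mulfK// pnatr_eq0.
Qed.

Section norm_estimates.
Variable R : realType.
Implicit Types z w : R[i].

(** The norm as a real number, since R[i] is not totally ordered and linear
    arithmetic needs a real field. *)
Definition cnorm z : R := complex.Re `|z|.

Lemma cnormE z : `|z| = (cnorm z)%:C.
Proof. by rewrite RRe_real// normr_real. Qed.

Lemma cnorm_ge0 z : 0 <= cnorm z.
Proof. by rewrite -lecR -cnormE; exact: normr_ge0. Qed.

Lemma cnormM z w : cnorm (z * w) = cnorm z * cnorm w.
Proof. by apply: complexI; rewrite rmorphM -!cnormE normrM. Qed.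

Lemma cnormX z n : cnorm (z ^+ n) = cnorm z ^+ n.
Proof. by apply: complexI; rewrite rmorphXn -!cnormE normrX. Qed.

Lemma cnormD z w : cnorm (z + w) <= cnorm z + cnorm w.
Proof. by rewrite -lecR rmorphD -!cnormE ler_normD. Qed.

Lemma cnorm_real (x : R) : cnorm x%:C = `|x|.
Proof. by rewrite /cnorm normc_real. Qed.

Lemma cnorm_le z (x : R) : (`|z| <= x%:C) = (cnorm z <= x).
Proof. by rewrite cnormE lecR. Qed.

Lemma lecR_half (x : R) : (x%:C <= 2^-1 :> R[i]) = (x <= 2^-1).
Proof. by rewrite -lecR fmorphV rmorph_nat. Qed.

Lemma cnorm_half z : (`|z| <= 2^-1) = (cnorm z <= 2^-1).
Proof. by rewrite cnormE lecR_half. Qed.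

End norm_estimates.

(** The bounded solution is geometric, y_k = G (v z G)^k, and the equations for
    it all reduce to the quadratic equation for G. *)
Lemma semicircle_series (R : realType) (m v : R) (z : R[i]) : 0 < v ->
  cnorm z * (1 + `|m| + v) <= 16^-1 ->
  exists G : R[i]^o, [/\ G = 1 + m%:C * z * G + v%:C * z ^+ 2 * G ^+ 2,
    cnorm G <= 4 &
    (fun N => \sum_(0 <= l < N) (moment (semicircle m v) l)%:C * z ^+ l : R[i]^o)
      @ \oo --> G].
Proof.
move=> v0 zK.
have z0 := cnorm_ge0 z; have m0 := normr_ge0 m.
have zm0 : 0 <= cnorm z * `|m| by rewrite mulr_ge0.
have zv0 : 0 <= cnorm z * v by rewrite mulr_ge0// ltW.
have zm : `|m%:C * z| <= 2^-1.
  by rewrite cnorm_half cnormM cnorm_real; lra.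
have [G [GE G4]] := quadratic_root v%:C zm.
have {}G4 : cnorm G <= 4 by rewrite -cnorm_le rmorph_nat.
exists G; split => //.
pose w := v%:C * z * G.
have w1 : cnorm w <= 1.
  rewrite /w !cnormM cnorm_real (ger0_norm (ltW v0)).
  have : v * cnorm z * cnorm G <= v * cnorm z * 4.
    by rewrite ler_wpM2l// mulr_ge0// ltW.
  lra.
under eq_fun do under eq_bigr do rewrite moment_semicircle//.
pose y k : R[i]^o := G * w ^+ k.
rewrite (_ : G = y 0%N); last by rewrite /y mulr1.
apply: (@jacobi_resolvent _ _ _ _ (1 + `|m| + v)%:C 4 z y).
- move=> k; rewrite lecR normr1.
  have : `|if k is 0%N then 0 else v| <= v.
    by case: k => [|k]; rewrite ?normr0 ?ger0_norm// ltW.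
  lra.
- by rewrite cnormE -rmorphM lecR_half; lra.
- move=> k; rewrite -(rmorph_nat (real_complex R) 4) cnorm_le cnormM cnormX.
  have : cnorm w ^+ k <= 1 by rewrite exprn_ile1 ?cnorm_ge0.
  have : 0 <= cnorm w ^+ k by rewrite exprn_ge0 ?cnorm_ge0.
  by have := cnorm_ge0 G; nra.
- case=> [|k]; rewrite /y /=.
    by rewrite /w {1}GE rmorph0 rmorph1; ring.
  have -> : G * w ^+ k.+1 = v%:C * z * w ^+ k * G * G by rewrite exprS /w; ring.
  by rewrite {1}GE !exprS /w rmorph1; ring.
Qed.

(** * Moment series of A A* *)

(** With s = sqrt lambda and t_k = sqrt omega_k, let A x have coordinates
    t_k x_(k-1) + s x_k, so that P = A A*. The tridiagonal operator A* A has
    diagonal s^2 + t_(k+1)^2 and off-diagonal s t_k; its resolvent x is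
    explicit, as the weights are constant from index 3 on, and the resolvent of
    A A* is y = delta_0 + z s A x because A* delta_0 = s delta_0. *)
Section resolvent_coordinates.
Variables (F : fieldType) (s z G K M : F) (t : nat -> F).
Hypothesis t0 : t 0%N = 0.
Hypothesis t3 : forall k, t k.+3 = t 3%N.
Hypothesis GE :
  G = 1 + (s ^+ 2 + t 3%N ^+ 2) * z * G + s ^+ 2 * t 3%N ^+ 2 * z ^+ 2 * G ^+ 2.
Hypothesis KE :
  K * (1 - z * (s ^+ 2 + t 2%N ^+ 2 + s ^+ 2 * t 2%N ^+ 2 * z * G)) = 1.
Hypothesis ME :
  M * (1 - z * (s ^+ 2 + t 1%N ^+ 2 + s ^+ 2 * t 1%N ^+ 2 * z * K)) = 1.

Definition AstarA_coord k : F := match k with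
  | 0%N => M
  | 1%N => z * s * t 1%N * (K * M)
  | k'.+2 => z * s * t 1%N * (K * M) * (z * s * t 2%N * G) *
             (z * s * t 3%N * G) ^+ k'
  end.
Local Notation x := AstarA_coord.

Definition AAstar_coord k : F :=
  (k == 0%N)%:R + z * s * (t k * x k.-1 + s * x k).
Local Notation y := AAstar_coord.

Lemma AstarA_coordE k : x k = (k == 0%N)%:R + z * ((s ^+ 2 + t k.+1 ^+ 2) * x k
  + s * t k.+1 * x k.+1 + s * t k * x k.-1).
Proof.
case: k => [|[|[|k]]]; rewrite /= ?add0r.
- by rewrite -[X in _ = X + _]ME t0; ring.
- have KJ := KE; set J := s ^+ 2 + t 2%N ^+ 2 + _ in KJ.
  transitivity (z * s * t 1%N * M * (K * (1 - z * J))
    + z * z * s * t 1%N * K * M * J).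
    by ring.
  by rewrite KJ /J; ring.
- by rewrite expr0 expr1 mulr1 {1}GE; ring.
- rewrite !t3 !(exprS _ k.+1) exprS; set X := _ ^+ k.
  set Y := z * s * t 1%N * (K * M) * (z * s * t 2%N * G).
  have -> : Y * (z * s * t 3%N * G * X) = z * s * t 3%N * Y * X * G by ring.
  by rewrite {1}GE; ring.
Qed.

(** With A* y = s x, the identity y = delta_0 + z A (A* y) is the definition of
    y. *)
Lemma AAstar_coordE k : y k = (k == 0%N)%:R + z * ((s ^+ 2 + t k ^+ 2) * y k
  + s * t k * y k.-1 + s * t k.+1 * y k.+1).
Proof.
(* This is A* y = s x, by the equation for x. *)
have Ay j : t j.+1 * y j.+1 + s * y j = s * x j.
  by rewrite [in RHS]AstarA_coordE /AAstar_coord/=; ring.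
case: k => [|k].
  transitivity (1 + z * s * (s * x 0%N)).
    by rewrite /AAstar_coord t0 mul0r add0r.
  by rewrite -Ay t0 /=; ring.
have -> : z * ((s ^+ 2 + t k.+1 ^+ 2) * y k.+1 + s * t k.+1 * y k
    + s * t k.+2 * y k.+2) =
  z * (t k.+1 * (t k.+1 * y k.+1 + s * y k)
    + s * (t k.+2 * y k.+2 + s * y k.+1)) by ring.
by rewrite !Ay /AAstar_coord/=; ring.
Qed.

End resolvent_coordinates.

Lemma cnorm_inv_1B (R : realType) (w : R[i]) : cnorm w <= 2^-1 ->
  1 - w != 0 /\ cnorm (1 - w)^-1 <= 2.
Proof.
move=> w2.
have h : 2^-1 <= cnorm (1 - w).
  rewrite -lecR -cnormE fmorphV rmorph_nat.
  by apply: half_le_norm_1B; rewrite cnorm_half.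
have n0 : 0 < cnorm (1 - w) by lra.
have w1 : 1 - w != 0.
  by apply: contraTneq n0 => ->; rewrite /cnorm normr0 ltxx.
split=> //.
have E : cnorm (1 - w)^-1 * cnorm (1 - w) = 1.
  by rewrite -cnormM mulVf// /cnorm normr1.
by rewrite -(ler_pM2r n0) E; lra.
Qed.

(** Every level of the continued fraction has this shape, X being the value of
    the next level; each value is bounded by 4, which closes the chain. *)
Lemma cnorm_continuant (R : realType) (lam w : R) (z X : R[i]) :
  0 < lam -> 0 <= w <= 1 -> cnorm z * (1 + lam) <= 64^-1 -> cnorm X <= 4 ->
  cnorm (z * ((lam + w)%:C + (lam * w)%:C * z * X)) <= 2^-1.
Proof.
move=> lam0 /andP[w0 w1] zS X4.
have z0 := cnorm_ge0 z; have X0 := cnorm_ge0 X.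
have zl0 : 0 <= cnorm z * lam by rewrite mulr_ge0// ltW.
have -> : z * ((lam + w)%:C + (lam * w)%:C * z * X) =
  z * (lam + w)%:C + (z * (lam * w)%:C) * (z * X) by ring.
apply: le_trans (cnormD _ _) _; rewrite !cnormM !cnorm_real.
rewrite !ger0_norm ?addr_ge0 ?mulr_ge0 ?(ltW lam0)//.
have h1 : cnorm z * (lam + w) <= cnorm z * (lam + 1).
  by rewrite ler_wpM2l// lerD2l.
have h2 : lam * w <= lam by rewrite ler_piMr// ltW.
have h3 : cnorm z * (lam * w) <= cnorm z * lam by rewrite ler_wpM2l.
have h4 : cnorm z * cnorm X <= 1.
  have : cnorm z * cnorm X <= cnorm z * 4 by rewrite ler_wpM2l.
  lra.
have h5 : cnorm z * (lam * w) * (cnorm z * cnorm X) <= cnorm z * (lam * w).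
  by rewrite ler_piMr// !mulr_ge0// ltW.
lra.
Qed.

Lemma sqrt_le_add1 (R : realType) (lam : R) : 0 < lam -> Num.sqrt lam <= 1 + lam.
Proof.
by move=> lam0; have := sqr_sqrtr (ltW lam0); have := sqrtr_ge0 lam; nra.
Qed.

Lemma jacobi_series (R : realType) (lam : R) (om : nat -> R) (z G K : R[i]) :
  0 < lam -> om 0%N = 0 -> (forall k, 0 <= om k <= 1) ->
  (forall k, om k.+3 = om 3%N) ->
  G = 1 + (lam + om 3%N)%:C * z * G + (lam * om 3%N)%:C * z ^+ 2 * G ^+ 2 ->
  cnorm G <= 4 ->
  K = (1 - z * ((lam + om 2%N)%:C + (lam * om 2%N)%:C * z * G))^-1 ->
  cnorm z * (1 + lam) <= 64^-1 ->
  (fun N => \sum_(0 <= n < N) (jacobi_pow (fun k => lam + om k)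
     (fun k => Num.sqrt lam * Num.sqrt (om k))
     (fun k => Num.sqrt lam * Num.sqrt (om k.+1)) n 0)%:C * z ^+ n : R[i]^o)
    @ \oo --> (1 + lam%:C * z *
      (1 - z * ((lam + om 1%N)%:C + (lam * om 1%N)%:C * z * K))^-1 : R[i]^o).
Proof.
move=> lam0 om0 om01 om3 GE G4 KE zS.
have om_ge0 k : 0 <= om k by have /andP[] := om01 k.
have om_le1 k : om k <= 1 by have /andP[] := om01 k.
have [zJ2 K2] := cnorm_inv_1B (cnorm_continuant lam0 (om01 2%N) zS G4).
rewrite -KE in K2.
have K4 : cnorm K <= 4 by lra.
have [zJ1 M2] := cnorm_inv_1B (cnorm_continuant lam0 (om01 1%N) zS K4).
set M := (1 - _)^-1 in M2 *.
pose s : R[i] := (Num.sqrt lam)%:C.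
pose t k : R[i] := (Num.sqrt (om k))%:C.
have s2 : s ^+ 2 = lam%:C by rewrite -rmorphXn sqr_sqrtr// ltW.
have t2 k : t k ^+ 2 = (om k)%:C by rewrite -rmorphXn sqr_sqrtr.
have t0 : t 0%N = 0 by rewrite /t om0 sqrtr0.
have t3 k : t k.+3 = t 3%N by rewrite /t om3.
have GE' : G = 1 + (s ^+ 2 + t 3%N ^+ 2) * z * G
    + s ^+ 2 * t 3%N ^+ 2 * z ^+ 2 * G ^+ 2.
  by rewrite s2 t2 -rmorphD -rmorphM.
have KE' : K * (1 - z * (s ^+ 2 + t 2%N ^+ 2 + s ^+ 2 * t 2%N ^+ 2 * z * G)) = 1.
  by rewrite s2 t2 -rmorphD -rmorphM KE mulVf.
have ME' : M * (1 - z * (s ^+ 2 + t 1%N ^+ 2 + s ^+ 2 * t 1%N ^+ 2 * z * K)) = 1.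
  by rewrite s2 t2 -rmorphD -rmorphM mulVf.
pose x := AstarA_coord s z G K M t.
pose y : nat -> R[i]^o := AAstar_coord s z G K M t.
have z0 := cnorm_ge0 z.
have zl0 : 0 <= cnorm z * lam by rewrite mulr_ge0// ltW.
have sS := sqrt_le_add1 lam0.
have tk1 k : Num.sqrt (om k) <= 1 by rewrite -[leRHS]sqrtr1 ler_wsqrtr.
have st_le k : cnorm (z * s * t k) <= 64^-1.
  rewrite !cnormM !cnorm_real !ger0_norm ?sqrtr_ge0//.
  apply: le_trans zS; apply: le_trans (_ : cnorm z * Num.sqrt lam * 1 <= _).
    by rewrite ler_wpM2l// mulr_ge0// sqrtr_ge0.
  by rewrite mulr1 ler_wpM2l.
have stG_le k : cnorm (z * s * t k * G) <= 1.
  rewrite cnormM; have := st_le k; have := cnorm_ge0 (z * s * t k).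
  by have := cnorm_ge0 G; nra.
have x1 : cnorm (x 1%N) <= 1.
  rewrite /x /= cnormM (cnormM K).
  have := st_le 1%N; have := cnorm_ge0 (z * s * t 1%N).
  have := cnorm_ge0 K; have := cnorm_ge0 M => a b c d.
  have : cnorm K * cnorm M <= 4 by nra.
  have : 0 <= cnorm K * cnorm M by rewrite mulr_ge0.
  by nra.
have x_le k : cnorm (x k) <= 2.
  case: k => [|[|k]] //; first by lra.
  rewrite [x _](_ : _ = x 1%N * (z * s * t 2%N * G) * (z * s * t 3%N * G) ^+ k)//.
  rewrite 2!cnormM cnormX.
  have h : cnorm (z * s * t 3%N * G) ^+ k <= 1 by rewrite exprn_ile1 ?cnorm_ge0.
  have h0 : 0 <= cnorm (z * s * t 3%N * G) ^+ k by rewrite exprn_ge0 ?cnorm_ge0.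
  have := stG_le 2%N; have := cnorm_ge0 (z * s * t 2%N * G).
  have := cnorm_ge0 (x 1%N) => a b c.
  have : cnorm (x 1%N) * cnorm (z * s * t 2%N * G) <= 1 by nra.
  have : 0 <= cnorm (x 1%N) * cnorm (z * s * t 2%N * G) by rewrite mulr_ge0.
  by nra.
have y_le k : cnorm (y k) <= 2.
  have -> : y k = (k == 0%N)%:R + (z * s * t k * x k.-1 + z * lam%:C * x k).
    by rewrite /y /AAstar_coord -/x -s2; ring.
  apply: le_trans (cnormD _ _) _.
  have : cnorm ((k == 0%N)%:R : R[i]) <= 1.
    by rewrite -cnorm_le normr_nat; case: eqP => _; rewrite ?lexx ?ler01.
  have := cnormD (z * s * t k * x k.-1) (z * lam%:C * x k).
  rewrite (cnormM (z * s * t k)) (cnormM (z * lam%:C)) (cnormM z) cnorm_real.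
  rewrite (gtr0_norm lam0).
  have := x_le k; have := x_le k.-1; have := cnorm_ge0 (x k).
  have := cnorm_ge0 (x k.-1); have := st_le k; have := cnorm_ge0 (z * s * t k).
  move=> a b c d e f.
  have : cnorm (z * s * t k) * cnorm (x k.-1) <= 4^-1 by nra.
  have : cnorm z * lam * cnorm (x k) <= 4^-1 by nra.
  lra.
rewrite (_ : 1 + _ = y 0%N); last first.
  by rewrite /y /AAstar_coord /= t0 mul0r add0r -s2; ring.
apply: (@jacobi_resolvent _ _ _ _ (3 * (1 + lam))%:C 2 z y).
- move=> k; rewrite lecR.
  have b j : `|Num.sqrt lam * Num.sqrt (om j)| <= 1 + lam.
    rewrite ger0_norm ?mulr_ge0 ?sqrtr_ge0//.
    by apply: le_trans sS; rewrite ler_piMr// sqrtr_ge0.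
  have := b k; have := b k.+1; have := om_le1 k.
  rewrite (ger0_norm (addr_ge0 (ltW lam0) (om_ge0 k))).
  lra.
- by rewrite cnormE -rmorphM lecR_half; lra.
- by move=> k; rewrite -(rmorph_nat (real_complex R) 2) cnorm_le.
- move=> k; rewrite {1}[y k](AAstar_coordE t0 t3 GE' KE' ME').
  by rewrite rmorphD !rmorphM/= -s2 -t2.
Qed.

(** * The quantum walk *)

Lemma cvg_mull (R : realType) (z : R[i]) (u : nat -> R[i]^o) (l : R[i]^o) :
  u @ \oo --> l -> (fun N => z * u N : R[i]^o) @ \oo --> (z * l : R[i]^o).
Proof. exact: cvgMl_tmp. Qed.

Lemma eq_cvgn (R : realType) (u v : nat -> R[i]^o) (l : R[i]^o) :
  (forall N, u N = v N) -> u @ \oo --> l -> v @ \oo --> l.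
Proof. by move=> /funext ->. Qed.

Section omega_bounds.
Variables (R : realType) (r : R).
Hypotheses (r0 : 0 < r) (r1 : r < 1).

Lemma omegaQW_bounds k : 0 <= omegaQW r k <= 1.
Proof.
have rr0 : 0 < r := r0.
have rr1 : r < 1 := r1.
have q0 : 0 <= Num.sqrt (1 - r ^+ 2) := sqrtr_ge0 _.
have q1 : Num.sqrt (1 - r ^+ 2) <= 1.
  by rewrite -[leRHS]sqrtr1 ler_wsqrtr// gerBl sqr_ge0.
case: k => [|[|[|k]]] /=; first by rewrite lexx ler01.
- by apply/andP; split; lra.
- by apply/andP; split; nra.
- by apply/andP; split; nra.
Qed.

Lemma omegaQW3_gt0 : 0 < omegaQW r 3%N.
Proof. by rewrite /= divr_gt0// exprn_gt0. Qed.

End omega_bounds.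

Section generating_series.
Variables (R : realType) (r lam : R).
Hypotheses (r0 : 0 < r) (r1 : r < 1) (lam0 : 0 < lam).
Local Notation om := (omegaQW r).
Local Notation C := (R[i]^o).

Definition jacobiQW (n k : nat) : R := jacobi_pow (fun k => lam + om k)
  (fun k => Num.sqrt lam * Num.sqrt (om k))
  (fun k => Num.sqrt lam * Num.sqrt (om k.+1)) n k.

Lemma near0_small : \forall z \near (0 : C), cnorm z * (1 + lam) <= 64^-1.
Proof.
have l1 : 0 < 1 + lam by rewrite addr_gt0.
have e0 : 0 < ((64 * (1 + lam))^-1)%:C :> R[i] by rewrite ltcR invr_gt0 mulr_gt0.
have := @nbhs0_le _ C _ e0.
apply: filterS => z; rewrite cnorm_le invfM => zl.
by rewrite -ler_pdivlMr.
Qed.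

(** The nested series are geometric and are summed from the inside out: the
    innermost one is z (G - 1), and each of the two others is
    z (1 / (1 - z J) - 1) with J the preceding level. What results is the
    continued fraction of [jacobi_series]. *)
Lemma moment_identity_jacobiQW : moment_identity r lam (jacobiQW ^~ 0%N).
Proof.
have := near0_small; apply: filterS => z zS.
have z0 := cnorm_ge0 z.
have zl0 : 0 <= cnorm z * lam by rewrite mulr_ge0// ltW.
have w3 := omegaQW3_gt0 r0.
have /andP[_ w3_1] := omegaQW_bounds r0 r1 3.
have v0 : 0 < lam * om 3%N by rewrite mulr_gt0.
have h3 : cnorm z * (1 + `|lam + om 3%N| + lam * om 3%N) <= 16^-1.
  rewrite ger0_norm ?addr_ge0 ?(ltW w3) ?(ltW lam0)//.
  have : cnorm z * om 3%N <= cnorm z * 1 by rewrite ler_wpM2l.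
  have : cnorm z * lam * om 3%N <= cnorm z * lam * 1 by rewrite ler_wpM2l.
  have -> : cnorm z * (1 + (lam + om 3%N) + lam * om 3%N) =
    cnorm z * (1 + lam) + cnorm z * om 3%N + cnorm z * lam * om 3%N by ring.
  have : cnorm z * (1 + lam) <= 64^-1 := zS.
  have : cnorm z * (1 + lam) = cnorm z + cnorm z * lam by ring.
  lra.
have [G [GE G4 Gcvg]] := semicircle_series v0 h3.
have mu0 : moment (semicircle (lam + om 3%N) (lam * om 3%N)) 0 = 1.
  by rewrite moment_semicircle.
have c3 : (fun N => \sum_(1 <= l < N) term3 r lam z l) @ \oo --> (z * (G - 1) : C).
  have := cvg_sum_from1 Gcvg; rewrite mu0 rmorph1 mul1r expr0 => G1.
  apply: eq_cvgn (cvg_mull (z := z) G1) => N.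
  rewrite mulr_sumr; apply: eq_bigr => l _.
  by rewrite /term3 exprS mulrCA.
have i3 : inner3 r lam z = (lam + om 2%N)%:C + (lam * om 2%N)%:C * z * G.
  by rewrite /inner3 (cvg_lim _ c3)//; ring.
have small2 := cnorm_continuant lam0 (omegaQW_bounds r0 r1 2) zS G4.
have [_ K2] := cnorm_inv_1B small2.
rewrite -i3 in small2 K2.
have geom (J : C) : cnorm (z * J) <= 2^-1 ->
    (fun N => \sum_(1 <= k < N) z ^+ k.+1 * J ^+ k) @ \oo -->
    (z * ((1 - z * J)^-1 - 1) : C).
  rewrite -cnorm_half => /cvg_geometric_half => /(_ z)/cvg_sum_from1.
  rewrite expr0 mulr1 mulrBr mulr1.
  apply: eq_cvgn => N.
  by apply: eq_bigr => k _; rewrite exprMn exprS mulrA.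
set K := (1 - _)^-1 in K2.
have c2 : (fun N => \sum_(1 <= k < N) term2 r lam z k) @ \oo --> (z * (K - 1) : C).
  exact: geom.
have i2 : inner2 r lam z = (lam + om 1%N)%:C + (lam * om 1%N)%:C * z * K.
  by rewrite /inner2 (cvg_lim _ c2)//; ring.
have K4 : cnorm K <= 4 by lra.
have small1 := cnorm_continuant lam0 (omegaQW_bounds r0 r1 1) zS K4.
rewrite -i2 in small1.
have c1 : (fun N => \sum_(1 <= n < N) term1 r lam z n) @ \oo -->
    (z * ((1 - z * inner2 r lam z)^-1 - 1) : C) by exact: geom.
split; [exact: cvgP c3|exact: cvgP c2|exact: cvgP c1|].
have := @jacobi_series _ lam om z G K lam0 erefl (omegaQW_bounds r0 r1)
  (fun=> erefl) GE G4 _ zS.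
rewrite -i3 -i2 => /(_ erefl).
have -> : rhsQW r lam z = 1 + lam%:C * z * (1 - z * inner2 r lam z)^-1.
  by rewrite /rhsQW (cvg_lim _ c1)//; ring.
by [].
Qed.

End generating_series.

Section quantum_walk_operator.
Variables (R : realType) (H : hilbertType R).
Variables (Bp Bm : {linear H -> H}) (lam : R).

Lemma PQW_is_linear : linear (PQW Bp Bm lam).
Proof.
have shift (B : {linear H -> H}) c a u v :
    B (a *: u + v) + c *: (a *: u + v) = a *: (B u + c *: u) + (B v + c *: v).
  by rewrite linearP !scalerDr !scalerA mulrC addrACA.
by move=> a u v; rewrite /PQW !shift.
Qed.

HB.instance Definition _ := GRing.isLinear.Build R[i] H H _ (PQW Bp Bm lam)
  PQW_is_linear.

End quantum_walk_operator.

Lemma PQW_Phi (R : realType) (om : nat -> R) (H : hilbertType R)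
    (Phi : nat -> H) (Bp Bm : {linear H -> H}) (lam : R) k :
  om 0%N = 0 -> (forall j, 0 <= om j) -> 0 < lam ->
  (forall n, Bp (Phi n) = (Num.sqrt (om n.+1))%:C *: Phi n.+1) ->
  (forall n, Bm (Phi n.+1) = (Num.sqrt (om n.+1))%:C *: Phi n) ->
  Bm (Phi 0%N) = 0 ->
  PQW Bp Bm lam (Phi k) =
    (lam + om k)%:C *: Phi k
    + (Num.sqrt lam * Num.sqrt (om k))%:C *: Phi k.-1
    + (Num.sqrt lam * Num.sqrt (om k.+1))%:C *: Phi k.+1.
Proof.
move=> om0 om_ge0 lam0 BpPhi BmPhi BmPhi0.
have sqr x : 0 <= x -> Num.sqrt x * Num.sqrt x = x :> R.
  by move=> x0; rewrite -expr2 sqr_sqrtr.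
rewrite /PQW; case: k => [|k].
  rewrite BmPhi0 add0r linearZ/= BpPhi !scalerA -!rmorphM/= sqr ?(ltW lam0)//.
  by rewrite om0 sqrtr0 mulr0 scale0r !addr0 addrC.
rewrite BmPhi linearD/= !linearZ/= !BpPhi scalerDr !scalerA.
rewrite -!rmorphM/= sqr// sqr ?(ltW lam0)// rmorphD scalerDl.
set a := (om k.+1)%:C *: _; set b := _ *: Phi k.+2; set c := _ *: Phi k.
set d := _ *: Phi k.+1.
by rewrite [c + d]addrC addrACA [b + c]addrC addrA [a + d]addrC.
Qed.

Lemma moment_jacobiQW (R : realType) (r : R) (H : hilbertType R)
    (Phi : nat -> H) (Bp Bm : {linear H -> H}) (lam : R) (E : pvm H) n :
  0 < r -> r < 1 -> 0 < lam -> orthonormal_seq Phi ->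
  (forall n, Bp (Phi n) = (Num.sqrt (omegaQW r n.+1))%:C *: Phi n.+1) ->
  (forall n, Bm (Phi n.+1) = (Num.sqrt (omegaQW r n.+1))%:C *: Phi n) ->
  Bm (Phi 0%N) = 0 ->
  spectral_measure_of (PQW Bp Bm lam) E ->
  moment (spectral_distribution E (Phi 0%N)) n = jacobiQW r lam n 0.
Proof.
move=> r0 r1 lam0 oPhi BpPhi BmPhi BmPhi0 [[M EM] ET].
rewrite (moment_spectral_distribution (T := PQW Bp Bm lam) EM ET).
have om_ge0 j : 0 <= omegaQW r j by have /andP[] := omegaQW_bounds r0 r1 j.
suff key k : complex.Re (inner (Phi k) (iter n (PQW Bp Bm lam) (Phi 0%N))) =
    jacobiQW r lam n k by exact: key.
rewrite /jacobiQW; elim: n k => [|n IH] k /=.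
  by rewrite oPhi; case: eqP.
rewrite (Re_spectral_sym (T := PQW Bp Bm lam) ET).
rewrite [X in inner X _](PQW_Phi k erefl om_ge0 lam0 BpPhi BmPhi BmPhi0).
rewrite !Re_innerDl !(Re_innerC (_ *: _)) !Re_innerZr.
by rewrite !(Re_innerC (iter _ _ _)) !IH.
Qed.

Theorem theorem6p1 (R : realType) (r : R) (hr0 : 0 < r) (hr1 : r < 1)
  (H : hilbertType R) (Phi : nat -> H) (hPhi : complete_orthonormal_seq Phi)
  (Bp Bm : {linear H -> H})
  (hBp : bounded_near Bp (nbhs (0 : H))) (hBm : bounded_near Bm (nbhs (0 : H)))
  (hBpPhi : forall n, Bp (Phi n) = (Num.sqrt (omegaQW r n.+1))%:C *: Phi n.+1)
  (hBmPhi : forall n, Bm (Phi n.+1) = (Num.sqrt (omegaQW r n.+1))%:C *: Phi n)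
  (hBmPhi0 : Bm (Phi 0%N) = 0)
  (lam : R) (hlam : 0 < lam)
  (E : pvm H) (hE : spectral_measure_of (PQW Bp Bm lam) E) :
  let m := moment (spectral_distribution E (Phi 0%N)) in
  let w1 := omegaQW r 1%N in
  let w2 := omegaQW r 2%N in
  [/\ moment_identity r lam m,
      (forall a : nat -> R, moment_identity r lam a -> forall n, a n = m n) &
      [/\ m 1%N = lam,
          m 2%N = lam * (lam + w1),
          m 3%N = lam * (lam ^+ 2 + 3 * lam * w1 + w1 ^+ 2) &
          m 4%N = lam * (lam ^+ 3 + 6 * lam ^+ 2 * w1
                       + lam * w1 * (5 * w1 + w2) + w1 ^+ 3)]].
Proof.
move=> m w1 w2.
have mE n : m n = jacobiQW r lam n 0.
  exact: (moment_jacobiQW n hr0 hr1 hlam hPhi.1 hBpPhi hBmPhi hBmPhi0 hE).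
have mid : moment_identity r lam m.
  rewrite (_ : m = jacobiQW r lam ^~ 0%N); last exact/funext.
  exact: moment_identity_jacobiQW.
split=> //.
  move=> a aid; apply: (@power_series_inj R a m (rhsQW r lam)).
    by move: aid; apply: filterS => z [].
  by move: mid; apply: filterS => z [].
have /andP[w1_0 _] := omegaQW_bounds hr0 hr1 1.
have /andP[w2_0 _] := omegaQW_bounds hr0 hr1 2.
have s2 : Num.sqrt lam * Num.sqrt lam = lam by rewrite -expr2 sqr_sqrtr// ltW.
have t1 : Num.sqrt w1 * Num.sqrt w1 = w1 by rewrite -expr2 sqr_sqrtr.
have t2 : Num.sqrt w2 * Num.sqrt w2 = w2 by rewrite -expr2 sqr_sqrtr.
rewrite !mE /jacobiQW /w1 /w2.
have om0 : omegaQW r 0 = 0 by [].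
move: (omegaQW r) @w1 @w2 om0 s2 t1 t2 {w1_0 w2_0} => om w1 w2 om0 s2 t1 t2.
rewrite /= om0 sqrtr0 /w1 /w2.
(* The coefficients become polynomials in the square roots of lam, om 1 and
   om 2, which are replaced by variables. *)
move: (Num.sqrt (om 3%N)) => r3.
move: (Num.sqrt (om 2%N)) t2 => r2; rewrite /w2 => <-.
move: (Num.sqrt (om 1%N)) t1 => r1; rewrite /w1 => <-.
move: (Num.sqrt lam) s2 => s <-.
by split; ring.
Qed.
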